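(* Let $r\geq 1$. The integral $$\zeta^{\mathcal{C}}(s_1,s_2,\ldots,s_r)=\int\cdots\int_{[1,+\infty)^r}\frac{dx_1\,dx_2\cdots dx_r}{x_1^{s_1}(x_1+x_2)^{s_2}\cdots(x_1+\cdots+x_r)^{s_r}}$$ is convergent for all $(s_1,\ldots,s_r)\in\mathbb{C}^r$ satisfying $$\mathrm{Re}(s_1+s_2+\cdots+s_r)>r,\quad \mathrm{Re}(s_2+\cdots+s_r)>r-1,\quad\ldots,\quad \mathrm{Re}(s_r)>1$$ (that is, $\mathrm{Re}(s_j+s_{j+1}+\cdots+s_r)>r-j+1$ for every $1\leq j\leq r$). Moreover, the function $\zeta^{\mathcal{C}}(s_1,\ldots,s_r)$ can be analytically continued from this region to a meromorphic function on $\mathbb{C}^r$ whose possible poles lie on the union of a countable family of complex affine hyperplanes of $\mathbb{C}^r$.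
   Context: For a real number $t>0$ and $s\in\mathbb{C}$, $t^{s}=\exp(s\log t)$. The function $\zeta^{\mathcal{C}}$ is called the continuous multiple zeta function. *)

(* Defs.v *)
From HB Require Import structures.
From mathcomp Require Import all_boot all_order all_algebra.
From mathcomp Require Import complex.
From mathcomp Require Import all_classical all_reals all_analysis.

Set Implicit Arguments.
Unset Strict Implicit.
Unset Printing Implicit Defensive.

Import Order.TTheory GRing.Theory Num.Theory.
Import numFieldNormedType.Exports.

Local Open Scope classical_set_scope.
Local Open Scope ring_scope.
Local Open Scope complex_scope.

(* The library puts the modulus topology on R[i]^o, not on R[i] itself. With
   these instances ['rV[R[i]]_r] is a normed space over R[i], so that
   [differentiable f z] means complex (Frechet) differentiability. *)
HB.instance Definition _ (R : rcfType) :=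
  PseudoPointedMetric.copy R[i] R[i]^o.
HB.instance Definition _ (R : rcfType) := NormedModule.copy R[i] R[i]^o.

Section lebesgue_tuple.
Context {R : realType}.
Local Open Scope ereal_scope.

Let consp n (p : measurableTypeR R * n.-tuple (measurableTypeR R)) :
  n.+1.-tuple (measurableTypeR R) := [tuple of p.1 :: p.2].

(* Lebesgue measure on R^n, on the product sigma-algebra. *)
Fixpoint lebesgue_tuple (n : nat) :
    set (n.-tuple (measurableTypeR R)) -> \bar R :=
  match n with
  | 0%N => \d_([tuple] : 0.-tuple (measurableTypeR R))
  | n'.+1 => pushforward
      (@lebesgue_measure R \x @lebesgue_tuple n')
      (fun p => [tuple of p.1 :: p.2])
  end.

Let mconsp n : measurable_fun setT (@consp n).
Proof. exact: measurable_cons. Qed.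

Let unconsp n (t : n.+1.-tuple (measurableTypeR R)) :
  measurableTypeR R * n.-tuple (measurableTypeR R) :=
  (tnth t ord0, [tuple of behead t]).

Let munconsp n : measurable_fun setT (@unconsp n).
Proof.
apply/measurable_fun_pairP; split.
- exact: (@measurable_tnth _ (measurableTypeR R) n.+1 ord0).
- exact: (@measurable_behead _ (measurableTypeR R) n).
Qed.

Let consK n : cancel (@consp n) (@unconsp n).
Proof.
by move=> [a t]; congr pair; exact/val_inj.
Qed.

Section step.
Context n (m : {sigma_finite_measure
  set (n.-tuple (measurableTypeR R)) -> \bar R}).

Let step := pushforward (@lebesgue_measure R \x m) (@consp n).

Let step0 : step set0 = 0.
Proof. by rewrite /step /pushforward preimage_set0 measure0. Qed.

Let step_ge0 A : 0 <= step A.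
Proof. by rewrite /step /pushforward; exact: measure_ge0. Qed.

Let step_sigma_additive : semi_sigma_additive step.
Proof.
move=> F mF tF mUF; rewrite /step /pushforward preimage_bigcup.
have mpre A : measurable A -> measurable (@consp n @^-1` A).
  by move=> mA; rewrite -[X in measurable X]setTI; exact: mconsp.
apply: measure_semi_sigma_additive.
- by move=> k; exact: mpre.
- apply/trivIsetP => /= i j _ _ ij; rewrite -preimage_setI.
  by move/trivIsetP : tF => /(_ _ _ _ _ ij) ->//; rewrite preimage_set0.
- by rewrite -preimage_bigcup; exact: mpre.
Qed.

HB.instance Definition _ := isMeasure.Build _ _ _ step
  step0 step_ge0 step_sigma_additive.

Let step_sigma_finite : sigma_finite setT step.
Proof.
have /sigma_finiteP[F [TF ndF Foo]] := sigma_finiteT (@lebesgue_measure R).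
have /sigma_finiteP[G [TG ndG Goo]] := sigma_finiteT m.
exists (fun k => @unconsp n @^-1` (F k `*` G k)).
  rewrite -preimage_bigcup -(preimage_setT (@unconsp n)); congr (_ @^-1` _).
  rewrite -setXTT TF TG predeqE => -[x y]; split.
    move=> [/= [i _ Fix] [j _ Gjy]]; exists (maxn i j) => //; split.
    - by move: x Fix; exact/subsetPset/ndF/leq_maxl.
    - by move: y Gjy; exact/subsetPset/ndG/leq_maxr.
  by move=> [i _ []/= ? ?]; split; exists i.
move=> k; have [mF Fk] := Foo k; have [mG Gk] := Goo k; split.
  by rewrite -[X in measurable X]setTI; apply: munconsp => //; exact: measurableX.
rewrite /step /pushforward (_ : _ @^-1` _ = F k `*` G k).
  by rewrite product_measure1E// lte_mul_pinfty// ge0_fin_numE.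
rewrite -comp_preimage (_ : @unconsp n \o @consp n = id) ?preimage_id//.
by apply/funext => x; exact: consK.
Qed.

HB.instance Definition _ := Measure_isSigmaFinite.Build _ _ _ step
  step_sigma_finite.

Definition lebesgue_tuple_step : {sigma_finite_measure
  set (n.+1.-tuple (measurableTypeR R)) -> \bar R} := step.

End step.

Let lebesgue_tupleP n :
  exists m : {sigma_finite_measure set (n.-tuple (measurableTypeR R)) -> \bar R},
    @lebesgue_tuple n = m.
Proof.
elim: n => [|n [m IH]]; first by eexists.
by exists (lebesgue_tuple_step m); rewrite /= IH.
Qed.

Let lebesgue_tuple0 n : @lebesgue_tuple n set0 = 0.
Proof. by have [m ->] := lebesgue_tupleP n; exact: measure0. Qed.

Let lebesgue_tuple_ge0 n A : 0 <= @lebesgue_tuple n A.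
Proof. by have [m ->] := lebesgue_tupleP n; exact: measure_ge0. Qed.

Let lebesgue_tuple_sigma_additive n : semi_sigma_additive (@lebesgue_tuple n).
Proof.
by have [m ->] := lebesgue_tupleP n; exact: measure_semi_sigma_additive.
Qed.

HB.instance Definition _ n := isMeasure.Build _ _ _ (@lebesgue_tuple n)
  (@lebesgue_tuple0 n) (@lebesgue_tuple_ge0 n)
  (@lebesgue_tuple_sigma_additive n).

Let lebesgue_tuple_sigma_finite n : sigma_finite setT (@lebesgue_tuple n).
Proof. by have [m ->] := lebesgue_tupleP n; exact: sigma_finiteT. Qed.

HB.instance Definition _ n := Measure_isSigmaFinite.Build _ _ _
  (@lebesgue_tuple n) (@lebesgue_tuple_sigma_finite n).

End lebesgue_tuple.
Arguments lebesgue_tuple R n : clear implicits.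

Section complex_integral.
Context d (T : measurableType d) (R : realType).
Variables (mu : {measure set T -> \bar R}) (D : set T) (f : T -> R[i]).

Definition complex_integrable : Prop :=
  mu.-integrable D (fun x => (complex.Re (f x))%:E) /\
  mu.-integrable D (fun x => (complex.Im (f x))%:E).

Definition complex_integral : R[i] :=
  Rintegral mu D (fun x => complex.Re (f x)) +i*
  Rintegral mu D (fun x => complex.Im (f x)).

End complex_integral.

Section zetaC.
Context {R : realType}.

Definition cexp (z : R[i]) : R[i] :=
  (expR (complex.Re z))%:C * (cos (complex.Im z) +i* sin (complex.Im z)).

(* t ^ s, meaningful for t > 0 *)
Definition cpow (t : R) (s : R[i]) : R[i] := cexp (s * (ln t)%:C).

Variable r : nat.

Definition zetaC_domain : set (r.-tuple (measurableTypeR R)) :=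
  [set x | forall i, 1 <= (tnth x i : R)].

Definition zetaC_integrand (s : 'rV[R[i]]_r)
    (x : r.-tuple (measurableTypeR R)) : R[i] :=
  (\prod_(j < r) cpow (\sum_(i < r | (i <= j)%N) (tnth x i : R)) (s 0 j))^-1.

Definition zetaC_convergent (s : 'rV[R[i]]_r) : Prop :=
  complex_integrable (lebesgue_tuple R r) zetaC_domain (zetaC_integrand s).

(* The continuous multiple zeta function; a junk value where the integral
   does not converge. *)
Definition zetaC (s : 'rV[R[i]]_r) : R[i] :=
  complex_integral (lebesgue_tuple R r) zetaC_domain (zetaC_integrand s).

(* Indices start at 0, so the bound r - j + 1 for 1 <= j <= r reads r - j. *)
Definition zetaC_region : set 'rV[R[i]]_r :=
  [set s | forall j : 'I_r,
    r%:R - j%:R < complex.Re (\sum_(i < r | (j <= i)%N) s 0 i)].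

End zetaC.

Section several_complex_variables.
Context {R : realType} {r : nat}.
Implicit Types (f : 'rV[R[i]]_r -> R[i]) (z : 'rV[R[i]]_r).

Definition holomorphic_at f z : Prop := \forall w \near z, differentiable f w.

(* A meromorphic function is represented by a total function, whose values are
   unconstrained on the zero sets of the local denominators. The density of
   the nonzero set says that h vanishes identically on no component of U. *)
Definition meromorphic f : Prop :=
  forall p, exists (U : set 'rV[R[i]]_r) (g h : 'rV[R[i]]_r -> R[i]),
    [/\ open_nbhs p U,
        forall z, U z -> differentiable g z /\ differentiable h z,
        U `<=` closure [set z | h z != 0] &
        forall z, U z -> h z != 0 -> f z = g z / h z].

(* Contains all the poles of f. *)
Definition singular_set f : set 'rV[R[i]]_r := [set z | ~ holomorphic_at f z].

Definition affine_hyperplane (H : set 'rV[R[i]]_r) : Prop :=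
  exists (a : 'rV[R[i]]_r) (c : R[i]),
    a != 0 /\ H = [set z | \sum_(i < r) a 0 i * z 0 i = c].

Definition meromorphic_continuation (D : set 'rV[R[i]]_r) f F : Prop :=
  [/\ forall z, D z -> holomorphic_at f z,
      meromorphic F &
      forall z, D z -> F z = f z].

End several_complex_variables.

(* Main.v *)
Require Import Defs.
From HB Require Import structures.
From mathcomp Require Import all_boot all_order all_algebra.
From mathcomp Require Import complex ring lra.
From mathcomp Require Import all_classical all_reals all_analysis.
From mathcomp Require Import measurable_realfun.

Set Implicit Arguments.
Unset Strict Implicit.
Unset Printing Implicit Defensive.

Import Order.TTheory GRing.Theory Num.Theory.
Import numFieldNormedType.Exports.

Local Open Scope classical_set_scope.
Local Open Scope ring_scope.

(** The integrand is a product of powers of the partial sums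
    [y_j = x_1 + ... + x_j], and [y_j] runs over the half-line that starts at
    [y_(j-1) + 1]. The theorem is proved for a larger family, closed under the
    operations of the proof: the [j]-th factor is an arbitrary weight
    [w_j y = prod_a (y + a) ^ (- c_a)], where [a] is a natural number and [c_a] is
    a coordinate of [s] or an integer. Let [S_j] be the sum of the exponents of
    [w_j].

    Convergence. Up to constants [w_j] is the power [- S_j], and integrating
    [y_n, y_(n-1), ...] in turn produces the powers [1 - S_n],
    [2 - S_n - S_(n-1)], ... of the preceding partial sum. The integral therefore
    converges absolutely when every tail sum of the [S_i - 1], called excess here,
    has positive real part ([chain_majorant_le]). On this open set the integral
    is holomorphic in [s], because it is a Laplace integral
    ([differentiable_laplace], [differentiable_chain_integral]).

    Continuation. Integrating the derivative of [y * w_n y] in the last variable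
    gives ([functional_equation])
      [(S_n - 1) * Z = B + sum_a a * c_a * Z_a],
    where [Z_a] has one more factor [(y + a) ^ -1] in [w_n], and the boundary
    term [B] is an integral of the same family with one variable less. The last
    variable belongs to every tail, so all excesses of [Z_a] are larger by one
    than those of [Z], and those of [B] are among those of [Z]. Solving for [Z]
    extends it, by induction on the number of variables and on the number of
    steps, to the sets where all excesses have real part above [- k]; these sets
    exhaust the space. Everything rests on a single equation, used in a fixed
    order, so successive extensions agree by the shape of the recursion
    ([continuation_stable]).

    Poles. The only divisions are by the affine forms [S - 1] attached to weights.
    Weights form a countable set, and finitely many of them occur at each step, so
    the continuation is locally a quotient of a holomorphic function by a finite
    product of such forms ([polar_quotient_continuation]). *)

(** * The complex exponential *)

Section cexp_theory.
Context {R : realType}.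
Implicit Types (z : R[i]) (a b : R).
Local Open Scope complex_scope.

Lemma ReD z w : complex.Re (z + w) = complex.Re z + complex.Re w.
Proof. by case: z w => [? ?] [? ?]. Qed.
Lemma ImD z w : complex.Im (z + w) = complex.Im z + complex.Im w.
Proof. by case: z w => [? ?] [? ?]. Qed.
Lemma ReN z : complex.Re (- z) = - complex.Re z.
Proof. by case: z => [? ?]. Qed.
Lemma ImN z : complex.Im (- z) = - complex.Im z.
Proof. by case: z => [? ?]. Qed.
Lemma ReM z w : complex.Re (z * w) =
  complex.Re z * complex.Re w - complex.Im z * complex.Im w.
Proof. by case: z w => [? ?] [? ?]. Qed.
Lemma ImM z w : complex.Im (z * w) =
  complex.Re z * complex.Im w + complex.Im z * complex.Re w.
Proof. by case: z w => [? ?] [? ?]. Qed.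
Lemma Re_sum I (s : seq I) (f : I -> R[i]) :
  complex.Re (\sum_(i <- s) f i) = \sum_(i <- s) complex.Re (f i).
Proof. exact: (big_morph _ ReD erefl). Qed.
Lemma Im_sum I (s : seq I) (f : I -> R[i]) :
  complex.Im (\sum_(i <- s) f i) = \sum_(i <- s) complex.Im (f i).
Proof. exact: (big_morph _ ImD erefl). Qed.

Lemma ReMr z a : complex.Re (z * a%:C) = complex.Re z * a.
Proof. by rewrite ReM /= mulr0 subr0. Qed.
Lemma ImMr z a : complex.Im (z * a%:C) = complex.Im z * a.
Proof. by rewrite ImM /= mulr0 add0r. Qed.

Lemma RerM z a : complex.Re (a%:C * z) = a * complex.Re z.
Proof. by rewrite ReM /= mul0r subr0. Qed.
Lemma ImrM z a : complex.Im (a%:C * z) = a * complex.Im z.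
Proof. by rewrite ImM /= mul0r addr0. Qed.

Lemma normc_ge_Im z : `|complex.Im z|%:C <= `|z|.
Proof.
rewrite normc_def lecR -sqrtr_sqr ler_wsqrtr//.
by rewrite lerDr sqr_ge0.
Qed.

Lemma ge0_real_complex z : 0 <= z -> z = (complex.Re z)%:C.
Proof. by case: z => a b; rewrite lecE /= => /andP[/eqP b0 _]; congr (Complex _ _). Qed.

Lemma normc_le_ReIm z :
  `|z| <= (`|complex.Re z| + `|complex.Im z|)%:C.
Proof.
rewrite normc_def lecR -[leRHS]ger0_norm ?addr_ge0// -sqrtr_sqr ler_wsqrtr//.
rewrite sqrrD !real_normK ?num_real// [leRHS]addrAC lerDl.
by rewrite mulrn_wge0// mulr_ge0.
Qed.

Lemma cexp0 : cexp (0 : R[i]) = 1.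
Proof. by rewrite /cexp /= expR0 cos0 sin0 mul1r. Qed.

Lemma cexpD z w : cexp (z + w) = cexp z * cexp w.
Proof.
case: z w => [a b] [c d]; rewrite /cexp /= expRD cosD sinD; simpc.
by congr (_ +i* _); ring.
Qed.

Lemma cexpN z : cexp (- z) = (cexp z)^-1.
Proof.
have := cexpD z (- z); rewrite subrr cexp0 => /esym zN.
by rewrite (mulr1_eq zN).
Qed.

Lemma Re_cexp z : complex.Re (cexp z) = expR (complex.Re z) * cos (complex.Im z).
Proof. by rewrite /cexp ReM /= mul0r subr0. Qed.

Lemma Im_cexp z : complex.Im (cexp z) = expR (complex.Re z) * sin (complex.Im z).
Proof. by rewrite /cexp ImM /= mul0r addr0. Qed.

Lemma normr_Re_cexp z : `|complex.Re (cexp z)| <= expR (complex.Re z).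
Proof.
by rewrite Re_cexp normrM ger0_norm ?expR_ge0// ler_piMr ?expR_ge0// ler_norml cos_geN1 cos_le1.
Qed.

Lemma normr_Im_cexp z : `|complex.Im (cexp z)| <= expR (complex.Re z).
Proof.
by rewrite Im_cexp normrM ger0_norm ?expR_ge0// ler_piMr ?expR_ge0// ler_norml sin_geN1 sin_le1.
Qed.

Lemma mean_value_bound (f df : R -> R) (M a : R) :
  (forall x : R, is_derive x (1 : R) f (df x)) ->
  (forall c, `|c| <= `|a| -> `|df c| <= M) ->
  `|f a - f 0| <= M * `|a|.
Proof.
move=> fd dfM.
have cf (x : R) : {for x, continuous f}.
  by apply/differentiable_continuous/derivable1_diffP; have [] := fd x.
have [a0|a0] := leP 0 a.
  have [c|c ac ->] := @MVT_segment R f df 0 a a0 (fun x _ => fd x).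
    exact: continuous_subspaceT.
  rewrite subr0 normrM ler_wpM2r// dfM//.
  by move: ac; rewrite in_itv/= => /andP[c0 ca]; rewrite !ger0_norm.
have [c|c ac E] := @MVT_segment R f df a 0 (ltW a0) (fun x _ => fd x).
  exact: continuous_subspaceT.
rewrite distrC E sub0r normrM normrN ler_wpM2r// dfM//.
move: ac; rewrite in_itv/= => /andP[c0 ca].
by rewrite (ltr0_norm a0) ler0_norm// lerN2.
Qed.

Lemma normr_sin_le a : `|sin a| <= `|a|.
Proof.
have := @mean_value_bound sin cos 1 a (@is_derive_sin R).
by rewrite sin0 subr0 mul1r; apply => c _; rewrite ler_norml cos_geN1 cos_le1.
Qed.

Lemma normr_cosB1_le a : `|cos a - 1| <= `|a| ^+ 2.
Proof.
have := @mean_value_bound cos (fun x => - sin x) `|a| a (@is_derive_cos R).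
rewrite cos0 expr2; apply => c ca.
by rewrite normrN (le_trans (normr_sin_le c)).
Qed.

Lemma normr_sinBid_le a : `|sin a - a| <= `|a| ^+ 2.
Proof.
have := @mean_value_bound (fun x => sin x - x) (fun x => cos x - 1) `|a| a.
rewrite sin0 !subr0 expr2; apply => c.
move=> ca; have := @mean_value_bound cos (fun x => - sin x) 1 c (@is_derive_cos R).
rewrite cos0 mul1r => H; apply: (le_trans (H _) ca) => e _.
by rewrite normrN ler_norml sin_geN1 sin_le1.
Qed.

Lemma normr_expRB1_le a : `|expR a - 1| <= `|a| * expR `|a|.
Proof.
have := @mean_value_bound expR expR (expR `|a|) a (@is_derive_expR R).
rewrite expR0 mulrC; apply => c ca.
by rewrite ger0_norm ?expR_ge0// ler_expR (le_trans (ler_norm _)).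
Qed.

Lemma normr_expRB1Bid_le a : `|expR a - 1 - a| <= `|a| ^+ 2 * expR `|a|.
Proof.
have := @mean_value_bound (fun x => expR x - 1 - x) (fun x => expR x - 1)
  (`|a| * expR `|a|) a.
rewrite expR0 subrr !subr0 expr2 mulrAC; apply.
  move=> x; apply: is_derive_eq; rewrite ?subr0//.
move=> c ca; apply: (le_trans (normr_expRB1_le c)).
by rewrite ler_pM ?expR_ge0// ler_expR.
Qed.

(** Quadratic Taylor remainder. A common bound [m] on both coordinates stands
    in for the modulus, because integrals are estimated coordinate by
    coordinate. *)
Lemma cexp_remainder z (m : R) :
  `|complex.Re z| <= m -> `|complex.Im z| <= m ->
  `|complex.Re (cexp z - 1 - z)| <= 2 * (m ^+ 2 * expR m) /\
  `|complex.Im (cexp z - 1 - z)| <= 2 * (m ^+ 2 * expR m).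
Proof.
rewrite mulr_natl mulr2n !ReD !ImD !ReN !ImN Re_cexp Im_cexp /= subr0.
case: z => a b /= am bm.
have m0 : 0 <= m by exact: le_trans am.
have em : 1 <= expR m by rewrite -expR0 ler_expR.
have ea : expR a <= expR m by rewrite ler_expR (le_trans (ler_norm _)).
have ea' : expR `|a| <= expR m by rewrite ler_expR.
have m2 x : `|x| <= m -> `|x| ^+ 2 <= m ^+ 2 by move=> ?; rewrite lerXn2r ?nnegrE.
split.
- have -> : expR a * cos b - 1 - a = expR a * (cos b - 1) + (expR a - 1 - a) by ring.
  apply: (le_trans (ler_normD _ _)); apply: lerD.
    rewrite normrM (ger0_norm (expR_ge0 _)) mulrC ler_pM//.
    by apply: le_trans (normr_cosB1_le _) _; exact: m2.
  by apply: (le_trans (normr_expRB1Bid_le a)); rewrite ler_pM ?m2.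
- have -> : expR a * sin b - b = (expR a - 1) * sin b + (sin b - b) by ring.
  apply: (le_trans (ler_normD _ _)); apply: lerD.
    rewrite normrM expr2 mulrAC ler_pM//; last by apply: le_trans (normr_sin_le _) _.
    by apply: (le_trans (normr_expRB1_le a)); rewrite ler_pM.
  apply: (le_trans (normr_sinBid_le b)); apply: (@le_trans _ _ (m ^+ 2)); first exact: m2.
  by rewrite ler_peMr// sqr_ge0.
Qed.

End cexp_theory.

(** * Linearity and bounds for complex integrals *)

Section complex_integral_theory.
Context d (T : measurableType d) (R : realType).
Variables (mu : {measure set T -> \bar R}) (D : set T).
Hypothesis mD : measurable D.
Implicit Types (f g : T -> R[i]) (c : R[i]).
Local Open Scope complex_scope.

Lemma le_complex_integrable (g : T -> R) f :
  mu.-integrable D (EFin \o g) ->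
  measurable_fun D (fun x => complex.Re (f x)) ->
  measurable_fun D (fun x => complex.Im (f x)) ->
  (forall x, D x -> `|complex.Re (f x)| <= g x) ->
  (forall x, D x -> `|complex.Im (f x)| <= g x) ->
  complex_integrable mu D f.
Proof.
move=> ig mR mI fR fI; split; apply: le_integrable ig => //.
- exact/measurable_EFinP.
- by move=> x Dx /=; rewrite lee_fin (le_trans (fR _ Dx))// ler_norm.
- exact/measurable_EFinP.
- by move=> x Dx /=; rewrite lee_fin (le_trans (fI _ Dx))// ler_norm.
Qed.

Lemma eq_complex_integral f g : (forall x, D x -> f x = g x) ->
  complex_integral mu D f = complex_integral mu D g.
Proof.
move=> fg; rewrite /complex_integral; congr (_ +i* _);
  by apply: eq_Rintegral => x; rewrite inE => /fg ->.
Qed.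

Lemma eq_complex_integrable f g : (forall x, D x -> f x = g x) ->
  complex_integrable mu D f -> complex_integrable mu D g.
Proof.
by move=> fg [fR fI]; split; [apply: eq_integrable fR|apply: eq_integrable fI] => //;
  move=> x; rewrite inE => /fg ->.
Qed.

Lemma complex_integrableD f g :
  complex_integrable mu D f -> complex_integrable mu D g ->
  complex_integrable mu D (fun x => f x + g x).
Proof.
move=> [fR fI] [gR gI]; split.
- have := integrableD mD fR gR; apply: eq_integrable => // x _ /=.
  by rewrite ReD.
- have := integrableD mD fI gI; apply: eq_integrable => // x _ /=.
  by rewrite ImD.
Qed.

Lemma complex_integralD f g :
  complex_integrable mu D f -> complex_integrable mu D g ->
  complex_integral mu D (fun x => f x + g x) =
  complex_integral mu D f + complex_integral mu D g.
Proof.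
move=> [fR fI] [gR gI]; rewrite /complex_integral; simpc; congr (_ +i* _).
- by rewrite -RintegralD//; apply: eq_Rintegral => x _; rewrite ReD.
- by rewrite -RintegralD//; apply: eq_Rintegral => x _; rewrite ImD.
Qed.

Lemma complex_integrableZ c f : complex_integrable mu D f ->
  complex_integrable mu D (fun x => c * f x).
Proof.
move=> [fR fI]; split.
- have := integrableB mD (integrableZl mD (complex.Re c) fR)
    (integrableZl mD (complex.Im c) fI).
  by apply: eq_integrable => // x _ /=; rewrite ReM.
- have := integrableD mD (integrableZl mD (complex.Re c) fI)
    (integrableZl mD (complex.Im c) fR).
  by apply: eq_integrable => // x _ /=; rewrite ImM.
Qed.

Lemma complex_integralZ c f : complex_integrable mu D f ->
  complex_integral mu D (fun x => c * f x) = c * complex_integral mu D f.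
Proof.
case: c => a b [fR fI].
have Z k h : mu.-integrable D (EFin \o h) -> mu.-integrable D (EFin \o (fun x => k * h x)).
  by move=> ih; have := integrableZl mD k ih; apply: eq_integrable.
rewrite /complex_integral; simpc; congr (_ +i* _).
- rewrite -!RintegralZl// -RintegralB//; [|exact: Z..].
  by apply: eq_Rintegral => x _; rewrite ReM.
- rewrite -!RintegralZl// -RintegralD//; [|exact: Z..].
  by apply: eq_Rintegral => x _; rewrite ImM.
Qed.

Lemma complex_integrable0 : complex_integrable mu D (fun=> 0).
Proof. by split; exact: integrable0. Qed.

Lemma complex_integrable_sum I (s : seq I) (F : I -> T -> R[i]) :
  (forall i, complex_integrable mu D (F i)) ->
  complex_integrable mu D (fun x => \sum_(i <- s) F i x).
Proof.
move=> iF; elim: s => [|i s IH].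
  by under eq_fun do rewrite big_nil; exact: complex_integrable0.
by under eq_fun do rewrite big_cons; exact: complex_integrableD.
Qed.

Lemma complex_integral_sum I (s : seq I) (F : I -> T -> R[i]) :
  (forall i, complex_integrable mu D (F i)) ->
  complex_integral mu D (fun x => \sum_(i <- s) F i x) =
  \sum_(i <- s) complex_integral mu D (F i).
Proof.
move=> iF; elim: s => [|i s IH].
  under eq_fun do rewrite big_nil; rewrite big_nil /complex_integral /=.
  by rewrite Rintegral_cst// mul0r.
under eq_fun do rewrite big_cons.
rewrite complex_integralD// ?IH ?big_cons//.
exact: complex_integrable_sum.
Qed.

Lemma norm_complex_integral_le (g : T -> R) f :
  mu.-integrable D (EFin \o g) ->
  complex_integrable mu D f ->
  (forall x, D x -> `|complex.Re (f x)| <= g x) ->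
  (forall x, D x -> `|complex.Im (f x)| <= g x) ->
  `|complex_integral mu D f| <= (2 * Rintegral mu D g)%:C.
Proof.
move=> ig [iR iI] fR fI; apply: le_trans (normc_le_ReIm _) _.
rewrite lecR mulr_natl mulr2n /=; apply: lerD;
  apply: le_trans (le_normr_Rintegral _ _) _ => //; apply: le_Rintegral => //.
- exact: (integrable_abse iR).
- exact: (integrable_abse iI).
Qed.

End complex_integral_theory.

(** * Holomorphy of Laplace integrals in several variables *)

Section complex_measurability.
Context d (T : measurableType d) (R : realType).
Implicit Types (D : set T) (f g : T -> R[i]).

Definition complex_measurable D f :=
  measurable_fun D (fun x => complex.Re (f x)) /\
  measurable_fun D (fun x => complex.Im (f x)).

Lemma complex_measurableM D f g :
  complex_measurable D f -> complex_measurable D g ->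
  complex_measurable D (fun x => f x * g x).
Proof.
move=> [fR fI] [gR gI]; split; under eq_fun do rewrite ?ReM ?ImM.
  by apply: measurable_funB; exact: measurable_funM.
by apply: measurable_funD; exact: measurable_funM.
Qed.

Lemma complex_measurableD D f g :
  complex_measurable D f -> complex_measurable D g ->
  complex_measurable D (fun x => f x + g x).
Proof.
move=> [fR fI] [gR gI]; split; under eq_fun do rewrite ?ReD ?ImD;
  exact: measurable_funD.
Qed.

Lemma complex_measurableN D f : complex_measurable D f ->
  complex_measurable D (fun x => - f x).
Proof.
move=> [fR fI]; split; under eq_fun do rewrite ?ReN ?ImN;
  exact: measurable_funN.
Qed.

Lemma complex_measurable_cst D (c : R[i]) : complex_measurable D (fun=> c).
Proof. by split; exact: measurable_cst. Qed.

Lemma complex_measurable_real D (g : T -> R) : measurable_fun D g ->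
  complex_measurable D (fun x => (g x)%:C%C).
Proof. by move=> mg; split => //=; exact: measurable_cst. Qed.

Lemma complex_measurable_sum D I (s : seq I) (F : I -> T -> R[i]) :
  (forall i, complex_measurable D (F i)) ->
  complex_measurable D (fun x => \sum_(i <- s) F i x).
Proof.
move=> mF; elim: s => [|i s IH].
  by under eq_fun do rewrite big_nil; exact: complex_measurable_cst.
by under eq_fun do rewrite big_cons; exact: complex_measurableD.
Qed.

Lemma complex_measurable_cexp D f : complex_measurable D f ->
  complex_measurable D (fun x => cexp (f x)).
Proof.
move=> [fR fI]; split; under eq_fun do rewrite ?Re_cexp ?Im_cexp;
  apply: measurable_funM; apply: measurableT_comp => //;
  apply: continuous_measurable_fun; [exact: continuous_cos|exact: continuous_sin].
Qed.

End complex_measurability.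

Section linear_forms.
Context {R : realType} {r : nat}.
Implicit Types (a : 'I_r -> R[i]) (h : 'rV[R[i]]_r).

Definition linear_form a h : R[i] := \sum_j a j * h 0 j.

Lemma linear_form_linear a : linear (linear_form a).
Proof.
move=> k u v; rewrite /linear_form scaler_sumr -big_split/=.
by apply: eq_bigr => j _; rewrite !mxE mulrDr; congr (_ + _); rewrite mulrCA.
Qed.

HB.instance Definition _ a :=
  @GRing.isLinear.Build _ _ _ _ _ (linear_form_linear a).

Lemma differentiable_bigsum (V : normedModType R[i]) I (s : seq I)
    (f : I -> V -> R[i]) z :
  (forall i, differentiable (f i) z) ->
  differentiable (fun w => \sum_(i <- s) f i w) z.
Proof.
move=> df; elim: s => [|i s IH].
  by under eq_fun do rewrite big_nil; exact: differentiable_cst.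
by under eq_fun do rewrite big_cons; exact: differentiableD.
Qed.

Lemma differentiable_linear_form a z : differentiable (linear_form a) z.
Proof.
apply: differentiable_bigsum => j.
by apply: differentiableM; [exact: differentiable_cst|exact: differentiable_coord].
Qed.

Lemma norm_coord_le h j : `|h 0 j| <= `|h|.
Proof.
rewrite {2}/Num.norm /= mx_normE.
have -> : `|h 0 j| = `|h 0 j|%:nng%:num by [].
rewrite num_le.
exact: (@le_bigmax_cond _ _ _ _ (0, j) xpredT
  (fun i : 'I_1 * 'I_r => `|h i.1 i.2|%:nng)).
Qed.

End linear_forms.

Section quadratic.
Variables (K : numFieldType) (V W : normedModType K).

Lemma differentiable_littleo (f : V -> W) (z : V) (L : {linear V -> W}) :
  continuous L -> f \o shift z = cst (f z) + L +o_ 0 id -> differentiable f z.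
Proof.
move=> cL dE; apply/diff_locallyP; have dL := diff_unique cL dE.
by split; rewrite dL.
Qed.

(** A bound on the remainder that is uniform for small [h] survives integration
    in a parameter. This is how derivatives are passed under the integral sign
    below. *)
Lemma differentiable_quadratic (f : V -> W) (z : V) (L : {linear V -> W}) (C d : K) :
  0 < d -> 0 <= C -> continuous L ->
  (forall h, `|h| <= d -> `|f (h + z) - f z - L h| <= C * `|h| ^+ 2) ->
  differentiable f z.
Proof.
move=> d0 C0 cL H; apply: (differentiable_littleo cL).
apply/eqaddoP => e e0; near=> h.
rewrite !fctE /= opprD addrA.
apply: le_trans (H h _) _.
  by near: h; apply: nbhs0_le.
rewrite expr2 mulrA ler_wpM2r//.
apply: (@le_trans _ _ ((C + 1) * `|h|)).
  by rewrite ler_wpM2r// lerDl.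
rewrite mulrC -ler_pdivlMr ?ltr_wpDl//.
by near: h; apply: nbhs0_le; rewrite divr_gt0 ?ltr_wpDl.
Unshelve. all: by end_near. Qed.

Lemma near_eq_differentiable (f g : V -> W) (z : V) :
  (\forall w \near z, f w = g w) -> differentiable g z -> differentiable f z.
Proof.
move=> fg dg; have fz := nbhs_singleton fg.
have [cL /eqaddoP gE] := (diff_locallyP _ _).1 dg.
have fg0 : \forall h \near (0 : V), f (h + z) = g (h + z).
  by move: fg; rewrite [X in X -> _](near_shift 0) subr0.
apply: (differentiable_littleo cL).
apply/eqaddoP => e e0; have := gE e e0; apply: filter_app; near=> h.
rewrite !fctE /= fz.
suff -> : f (h + z) = g (h + z) by [].
by near: h.
Unshelve. all: by end_near. Qed.

End quadratic.

Section laplace.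
Context d (T : measurableType d) (R : realType).
Variables (mu : {measure set T -> \bar R}) (D : set T).
Hypothesis mD : measurable D.
Variables (r : nat) (phi : 'I_r -> T -> R) (psi : T -> R).
Hypothesis mphi : forall j, measurable_fun D (phi j).
Hypothesis mpsi : measurable_fun D psi.
Hypothesis phi_ge0 : forall j x, D x -> 0 <= phi j x.

Definition laplace_exponent (s : 'rV[R[i]]_r) (x : T) : R[i] :=
  - (\sum_j s 0 j * (phi j x)%:C%C + (psi x)%:C%C).

Let kernel s x := cexp (laplace_exponent s x).
Let t x := \sum_j phi j x.

Lemma laplace_exponent_translate h s x : laplace_exponent (h + s) x =
  laplace_exponent s x + (- \sum_j h 0 j * (phi j x)%:C%C).
Proof.
rewrite /laplace_exponent -opprD; congr (- _); rewrite addrAC -big_split/=.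
by congr (_ + _); apply: eq_bigr => j _; rewrite mxE mulrDl addrC.
Qed.

Lemma sq_le_expR (a : R) : 0 <= a -> a ^+ 2 <= 2 * expR a.
Proof.
move=> a0; have := expR_ge1Dxn 1 a0.
by rewrite (_ : 2`!%:R = 2)//; lra.
Qed.

(** Differentiation under the integral sign. Moving [s] by [h] multiplies the
    kernel by [cexp (- u)], where [u] is linear in [h] and at most [|h| * t] in
    both coordinates. The quadratic remainder of the exponential is then at most
    a constant times [|h|^2] times the kernel at a point of the convergence
    domain with all coordinates lowered by [dl], because [t ^ 2] is dominated by
    an exponential of [t]. Such a point exists as soon as the domain is open. *)
Lemma differentiable_laplace (s : 'rV[R[i]]_r) (dl : R) : 0 < dl ->
  mu.-integrable D (fun x => (expR (complex.Re
    (laplace_exponent s x) + dl * t x))%:E) ->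
  differentiable (fun s => complex_integral mu D (kernel s)) s.
Proof.
move=> d0 iG.
pose G x := expR (complex.Re (laplace_exponent s x) + dl * t x).
have t_ge0 x : D x -> 0 <= t x by move=> Dx; apply: sumr_ge0 => j _; exact: phi_ge0.
have phi_t j x : D x -> phi j x <= t x.
  by move=> Dx; rewrite /t (bigD1 j)//= lerDl sumr_ge0// => i _; exact: phi_ge0.
have mk w : complex_measurable D (kernel w).
  apply/complex_measurable_cexp/complex_measurableN/complex_measurableD.
    apply: complex_measurable_sum => j; apply: complex_measurableM.
      exact: complex_measurable_cst.
    exact: complex_measurable_real.
  exact: complex_measurable_real.
have kD h x : kernel (h + s) x = kernel s x * cexp (- \sum_j h 0 j * (phi j x)%:C%C).
  by rewrite /kernel -cexpD laplace_exponent_translate.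
have uR (h : 'rV[R[i]]_r) (e : R) x : D x -> `|h| <= e%:C%C ->
    `|complex.Re (- \sum_j h 0 j * (phi j x)%:C%C)| <= e * t x /\
    `|complex.Im (- \sum_j h 0 j * (phi j x)%:C%C)| <= e * t x.
  move=> Dx he; rewrite ReN ImN !normrN Re_sum Im_sum /t mulr_sumr.
  split; apply: (le_trans (ler_norm_sum _ _ _)); apply: ler_sum => j _.
    rewrite ReMr normrM (ger0_norm (phi_ge0 _ Dx)) ler_wpM2r ?phi_ge0//.
    rewrite -lecR (le_trans (normc_ge_Re _))// (le_trans (norm_coord_le _ _))//.
  rewrite ImMr normrM (ger0_norm (phi_ge0 _ Dx)) ler_wpM2r ?phi_ge0//.
  rewrite -lecR (le_trans (normc_ge_Im _))// (le_trans (norm_coord_le _ _))//.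
have kR w x : `|complex.Re (kernel w x)| <= expR (complex.Re (laplace_exponent w x)).
  exact: normr_Re_cexp.
have kI w x : `|complex.Im (kernel w x)| <= expR (complex.Re (laplace_exponent w x)).
  exact: normr_Im_cexp.
have EG x : D x -> expR (complex.Re (laplace_exponent s x)) <= G x.
  by move=> Dx; rewrite ler_expR lerDl mulr_ge0 ?t_ge0// ltW.
have ik (h : 'rV[R[i]]_r) (e : R) : e <= dl -> `|h| <= e%:C%C ->
    complex_integrable mu D (kernel (h + s)).
  move=> ed he; have [mR mI] := mk (h + s).
  have B x : D x -> expR (complex.Re (laplace_exponent (h + s) x)) <= G x.
    move=> Dx; have [uh _] := uR _ _ _ Dx he.
    rewrite /G ler_expR laplace_exponent_translate.
    rewrite ReD lerD2l (le_trans (ler_norm _))// (le_trans uh)// ler_wpM2r//.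
    exact: t_ge0.
  apply: (@le_complex_integrable _ _ _ _ _ mD G) => // x Dx.
    exact: le_trans (kR _ _) (B _ Dx).
  exact: le_trans (kI _ _) (B _ Dx).
have ik0 : complex_integrable mu D (kernel s).
  have := ik 0 0 (ltW d0); rewrite add0r; apply.
  by rewrite normr0.
have ip j : complex_integrable mu D (fun x => (phi j x)%:C%C * kernel s x).
  have [mR mI] : complex_measurable D (fun x => (phi j x)%:C%C * kernel s x).
    by apply: complex_measurableM => //; exact: complex_measurable_real.
  have B x (v : R) : D x -> `|v| <= expR (complex.Re (laplace_exponent s x)) ->
      `|phi j x * v| <= dl^-1 * G x.
    move=> Dx vE; rewrite normrM (ger0_norm (phi_ge0 _ Dx)).
    rewrite -ler_pdivrMl ?invr_gt0// invrK mulrA /G addrC expRD ler_pM//.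
      by rewrite mulr_ge0 ?phi_ge0// ltW.
    apply: (@le_trans _ _ (dl * t x)); first by rewrite ler_wpM2l ?phi_t// ltW.
    by apply: le_trans (expR_ge1Dx _); rewrite lerDr.
  have iG' : mu.-integrable D (EFin \o (fun x => dl^-1 * G x)).
    by have := integrableZl mD dl^-1 iG; apply: eq_integrable.
  apply: (le_complex_integrable mD iG') => // x Dx.
    by rewrite RerM; exact: B.
  by rewrite ImrM; exact: B.
pose a j := - complex_integral mu D (fun x => (phi j x)%:C%C * kernel s x).
pose C : R := 32 / dl ^+ 2.
apply: (@differentiable_quadratic _ _ _ _ s (linear_form a)
  (2 * (C * Rintegral mu D G))%:C%C (dl / 2)%:C%C).
- by rewrite ltcR divr_gt0.
- rewrite ler0c !mulr_ge0// ?invr_ge0 ?sqr_ge0//.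
  by apply: Rintegral_ge0 => x _; exact: expR_ge0.
- by move=> x; exact/differentiable_continuous/differentiable_linear_form.
move=> h; rewrite (ge0_real_complex (normr_ge0 h)) lecR.
set e := complex.Re `|h| => ed.
have e0 : 0 <= e by rewrite /e -ler0c -ge0_real_complex.
have he : `|h| <= e%:C%C by rewrite -ge0_real_complex.
have ed' : e <= dl by apply: le_trans ed _; rewrite ler_pdivrMr// ler_peMr ?ler1n ?ltW.
pose rem x := kernel s x * (cexp (- \sum_j h 0 j * (phi j x)%:C%C) - 1 -
  (- \sum_j h 0 j * (phi j x)%:C%C)).
have remE x : rem x = kernel (h + s) x + (-1) * kernel s x +
    \sum_j h 0 j * ((phi j x)%:C%C * kernel s x).
  rewrite /rem kD opprK mulrDr mulrBr mulr1 mulN1r; congr (_ + _).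
  by rewrite mulr_sumr; apply: eq_bigr => j _; rewrite mulrC -mulrA.
have ik' := ik _ _ ed' he.
have i1 := complex_integrableZ mD (-1) ik0.
have i2 := complex_integrableD mD ik' i1.
have i3 j := complex_integrableZ mD (h 0 j) (ip j).
have i4 := complex_integrable_sum mD (index_enum _) i3.
have irem : complex_integrable mu D rem.
  by apply: (eq_complex_integrable mD _ (complex_integrableD mD i2 i4)) => x _; rewrite remE.
have -> : complex_integral mu D (kernel (h + s)) - complex_integral mu D (kernel s)
    - linear_form a h = complex_integral mu D rem.
  under [RHS]eq_complex_integral do rewrite remE.
  rewrite !complex_integralD// complex_integralZ// mulN1r; congr (_ + _).
  rewrite complex_integral_sum// /linear_form -sumrN; apply: eq_bigr => j _.
  by rewrite complex_integralZ// /a mulNr opprK mulrC.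
have iCG : mu.-integrable D (EFin \o (fun x => (C * e ^+ 2) * G x)).
  by have := integrableZl mD (C * e ^+ 2) iG; apply: eq_integrable.
have B x (k1 k2 v1 v2 : R) : D x ->
    `|k1| <= expR (complex.Re (laplace_exponent s x)) ->
    `|k2| <= expR (complex.Re (laplace_exponent s x)) ->
    `|v1| <= 2 * ((e * t x) ^+ 2 * expR (e * t x)) ->
    `|v2| <= 2 * ((e * t x) ^+ 2 * expR (e * t x)) ->
    `|k1 * v1 + k2 * v2| <= (C * e ^+ 2) * G x.
  move=> Dx k1E k2E v1E v2E; have tx := t_ge0 _ Dx.
  set E := expR (complex.Re (laplace_exponent s x)) in k1E k2E.
  set m := 2 * _ in v1E v2E.
  apply: (@le_trans _ _ (E * m + E * m)).
    by apply: (le_trans (ler_normD _ _)); rewrite !normrM lerD// ler_pM.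
  (* Half of the margin dl absorbs the factor t ^ 2, the other half the
     translation by h; this is where the constant 32 / dl ^ 2 comes from. *)
  have q1 : t x ^+ 2 <= 8 / dl ^+ 2 * expR (dl / 2 * t x).
    have : 0 <= dl / 2 * t x by apply: mulr_ge0 => //; apply: divr_ge0 => //; exact: ltW.
    move/sq_le_expR.
    rewrite exprMn -ler_pdivlMl ?exprn_gt0 ?divr_gt0// => /le_trans; apply.
    rewrite [leLHS](_ : _ = 8 / dl ^+ 2 * expR (dl / 2 * t x))//.
    by field; rewrite gt_eqF.
  have q2 : expR (e * t x) <= expR (dl / 2 * t x) by rewrite ler_expR ler_wpM2r.
  have -> : G x = E * (expR (dl / 2 * t x) * expR (dl / 2 * t x)).
    by rewrite /G /E -!expRD; congr expR; field.
  have -> : E * m + E * m = E * (4 * (e ^+ 2 * (t x ^+ 2 * expR (e * t x)))).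
    by rewrite /m exprMn; ring.
  have -> : C * e ^+ 2 * (E * (expR (dl / 2 * t x) * expR (dl / 2 * t x))) =
     E * (4 * (e ^+ 2 * (8 / dl ^+ 2 * expR (dl / 2 * t x) * expR (dl / 2 * t x)))).
    by rewrite /C; field; rewrite gt_eqF.
  rewrite ler_wpM2l ?expR_ge0// ler_wpM2l// ler_wpM2l ?sqr_ge0//.
  by rewrite ler_pM ?sqr_ge0 ?expR_ge0.
have -> : (2 * (C * Rintegral mu D G))%:C%C * e%:C%C ^+ 2 =
    (2 * Rintegral mu D (fun x => (C * e ^+ 2) * G x))%:C%C.
  rewrite RintegralZl// expr2 -!rmorphM/=; congr (_ %:C%C); ring.
apply: norm_complex_integral_le => // x Dx; have [uh1 uh2] := uR _ _ _ Dx he.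
  rewrite ReM -mulrN; apply: B => //; rewrite ?normrN.
    by have [] := cexp_remainder uh1 uh2.
  by have [] := cexp_remainder uh1 uh2.
rewrite ImM; apply: B => //.
  by have [] := cexp_remainder uh1 uh2.
by have [] := cexp_remainder uh1 uh2.
Qed.

End laplace.

(** * Iterated integration of tuples *)

Section tuple_fubini.
Context {R : realType}.
Local Open Scope ereal_scope.
Notation leb := (@lebesgue_measure R).
Notation cube n := (@zetaC_domain R n).
Let X := measurableTypeR R.

Lemma measurable_cube n : measurable (cube n).
Proof.
rewrite (_ : cube n = \bigcap_(i : 'I_n) ((fun t : n.-tuple X => tnth t i) @^-1` `[1%R, +oo[)).
  apply: fin_bigcap_measurable => // i _.
  by rewrite -[X in measurable X]setTI; apply: measurable_tnth.
apply/seteqP; split=> [t H i _ /=|t H i].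
  by rewrite in_itv/= andbT; exact: H.
by have := H i I; rewrite /= in_itv/= andbT.
Qed.

Lemma cube_cons n (x : R) (t : n.-tuple X) :
  cube n.+1 [tuple of x :: t] <-> (1 <= x)%R /\ cube n t.
Proof.
split=> [H|[x1 H]].
  split; first exact: (H ord0).
  by move=> i; have := H (lift ord0 i); rewrite tnthS.
by move=> i; case: (unliftP ord0 i) => [j ->|->//]; rewrite tnthS.
Qed.

Let consp n (p : X * n.-tuple X) : n.+1.-tuple X := [tuple of p.1 :: p.2].

Let mconsp n : measurable_fun setT (@consp n).
Proof. exact: measurable_cons. Qed.

Let patch_cons n (h : n.+1.-tuple X -> \bar R) (x : X) (t : n.-tuple X) :
  ((h \o @consp n) \_ (@consp n @^-1` cube n.+1)) (x, t) =
  if x \in `[1%R, +oo[%classic then ((fun t => h [tuple of x :: t]) \_ (cube n)) t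
  else 0.
Proof.
rewrite !patchE.
have -> : ((x, t) \in @consp n @^-1` cube n.+1) =
    (x \in `[1%R, +oo[%classic) && (t \in cube n).
  apply/idP/andP; rewrite !inE /= in_itv/= andbT => H; exact/cube_cons.
by case: (x \in _); case: (t \in _).
Qed.

Let mpre n : measurable (@consp n @^-1` cube n.+1).
Proof.
have := @mconsp n measurableT (cube n.+1); rewrite setTI; apply.
exact: measurable_cube.
Qed.

Lemma tonelli_tuple n (h : n.+1.-tuple X -> \bar R) :
  measurable_fun setT h -> (forall x, 0 <= h x) ->
  \int[lebesgue_tuple R n.+1]_(x in cube n.+1) h x =
  \int[leb]_(x in `[1%R, +oo[) \int[lebesgue_tuple R n]_(t in cube n) h [tuple of x :: t].
Proof.
move=> mh h0.
transitivity (\int[pushforward (leb \x lebesgue_tuple R n) (@consp n)]_(x in cube n.+1) h x).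
  exact: eq_measure_integral.
rewrite ge0_integral_pushforward; [|exact: mconsp|exact: measurable_cube|exact: measurable_funTS|by move=> *; exact: h0].
rewrite integral_mkcond fubini_tonelli1; last 2 first.
- apply/(measurable_restrictT _ (@mpre n)).
  by apply: measurable_funTS; exact: (measurableT_comp mh (@mconsp n)).
- by apply: erestrict_ge0 => p _; exact: h0.
rewrite [RHS]integral_mkcond; apply: eq_integral => x _.
rewrite /fubini_F; under eq_integral do rewrite patch_cons.
rewrite patchE; case: ifPn => _; first by rewrite -integral_mkcond.
by rewrite integral0.
Qed.

Lemma measurable_tonelli_tuple n (h : n.+1.-tuple X -> \bar R) :
  measurable_fun setT h -> (forall x, 0 <= h x) ->
  measurable_fun setT (fun x : R =>
    \int[lebesgue_tuple R n]_(t in cube n) h [tuple of x :: t]).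
Proof.
move=> mh h0.
have mD : measurable (setT `*` cube n : set (X * n.-tuple X)).
  by apply: measurableX => //; exact: measurable_cube.
rewrite (_ : (fun _ => _) = fubini_F (lebesgue_tuple R n)
    ((h \o @consp n) \_ (setT `*` cube n))).
  apply: measurable_fun_fubini_tonelli_F.
    apply/(measurable_restrictT _ mD); apply: measurable_funTS.
    exact: (measurableT_comp mh (@mconsp n)).
  by apply: erestrict_ge0 => p _; exact: h0.
apply/funext => x; rewrite /fubini_F [LHS]integral_mkcond; apply: eq_integral => t _.
rewrite !patchE; congr (if _ then _ else _).
by apply/idP/idP; rewrite !inE //= => -[].
Qed.

Lemma fubini_tuple n (g : n.+1.-tuple X -> R) :
  measurable_fun setT g ->
  (lebesgue_tuple R n.+1).-integrable (cube n.+1) (EFin \o g) ->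
  leb.-integrable `[1%R, +oo[ (fun x => \int[lebesgue_tuple R n]_(t in cube n)
    (g [tuple of x :: t])%:E) /\
  \int[lebesgue_tuple R n.+1]_(x in cube n.+1) (g x)%:E =
  \int[leb]_(x in `[1%R, +oo[) \int[lebesgue_tuple R n]_(t in cube n) (g [tuple of x :: t])%:E.
Proof.
move=> mg ig; have mEg : measurable_fun setT (EFin \o g) by exact/measurable_EFinP.
have mgc : measurable_fun (@consp n @^-1` cube n.+1) ((EFin \o g) \o @consp n).
  by apply: measurable_funTS; exact: (measurableT_comp mEg (@mconsp n)).
have igc : (leb \x lebesgue_tuple R n).-integrable (@consp n @^-1` cube n.+1)
    ((EFin \o g) \o @consp n).
  apply/integrableP; split => //.
  move/integrableP : ig => [_]; apply: le_lt_trans.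
  rewrite [leRHS](_ : _ = \int[pushforward (leb \x lebesgue_tuple R n) (@consp n)]_(x in cube n.+1) `|(EFin \o g) x|); last first.
    exact: eq_measure_integral.
  rewrite ge0_integral_pushforward//; [exact: mconsp|exact: measurable_cube|].
  by apply: measurable_funTS; exact: measurableT_comp.
have igcT := (integrable_mkcond _ (@mpre n)).1 igc.
have E x : fubini_F (lebesgue_tuple R n)
     (((EFin \o g) \o @consp n) \_ (@consp n @^-1` cube n.+1)) x =
   ((fun x => \int[lebesgue_tuple R n]_(t in cube n) (g [tuple of x :: t])%:E)
      \_ `[1%R, +oo[) x.
  rewrite /fubini_F; under eq_integral do rewrite patch_cons.
  rewrite patchE; case: ifPn => _; first by rewrite -integral_mkcond.
  by rewrite integral0.
split.
  apply/integrable_mkcond => //.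
  by apply: eq_integrable (integrable_fubini_F igcT) => // x _; rewrite E.
transitivity (\int[pushforward (leb \x lebesgue_tuple R n) (@consp n)]_(x in cube n.+1) (g x)%:E).
  exact: eq_measure_integral.
rewrite integral_pushforward//; [|exact: mconsp|exact: measurable_cube].
rewrite integral_mkcond -integral12_prod_meas1//.
by rewrite [RHS]integral_mkcond; apply: eq_integral => x _; rewrite E.
Qed.

Lemma complex_fubini_tuple n (g : n.+1.-tuple X -> R[i]) :
  complex_measurable setT g ->
  complex_integrable (lebesgue_tuple R n.+1) (cube n.+1) g ->
  (forall x : R, (1 <= x)%R -> complex_integrable (lebesgue_tuple R n) (cube n)
    (fun t => g [tuple of x :: t])) ->
  complex_integrable leb `[1%R, +oo[ (fun x =>
    complex_integral (lebesgue_tuple R n) (cube n) (fun t => g [tuple of x :: t])) /\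
  complex_integral (lebesgue_tuple R n.+1) (cube n.+1) g =
  complex_integral leb `[1%R, +oo[ (fun x =>
    complex_integral (lebesgue_tuple R n) (cube n) (fun t => g [tuple of x :: t])).
Proof.
move=> [mR mI] [iR iI] it.
have [jR eR] := fubini_tuple mR iR; have [jI eI] := fubini_tuple mI iI.
have fK x : x \in `[1%R, +oo[%classic ->
    (\int[lebesgue_tuple R n]_(t in cube n) (complex.Re (g [tuple of x :: t]))%:E =
    (Rintegral (lebesgue_tuple R n) (cube n) (fun t => complex.Re (g [tuple of x :: t])))%:E) /\
    (\int[lebesgue_tuple R n]_(t in cube n) (complex.Im (g [tuple of x :: t]))%:E =
    (Rintegral (lebesgue_tuple R n) (cube n) (fun t => complex.Im (g [tuple of x :: t])))%:E).
  rewrite inE /= in_itv/= andbT => /it[i1 i2].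
  by rewrite /Rintegral !fineK//; apply: integrable_fin_num => //; exact: measurable_cube.
split; first split.
- by apply: eq_integrable jR => // x /fK[].
- by apply: eq_integrable jI => // x /fK[].
rewrite /complex_integral /Rintegral eR eI; congr (_ +i* _)%C; congr fine.
- by apply: eq_integral => x /fK[-> _].
- by apply: eq_integral => x /fK[_ ->].
Qed.

End tuple_fubini.

(** * Integrals of derivatives on half-lines *)

Section real_integrals.
Context {R : realType}.
Notation leb := (@lebesgue_measure R).
Implicit Types (f g F G : R -> R) (a l m x y Y T : R).

Lemma cvg_ln_pinfty : ln x @[x --> +oo] --> (+oo : set_system R).
Proof.
apply/cvgryPge => A; near=> x.
have x0 : 0 < x by near: x; exact: nbhs_pinfty_gt.
have -> : (A <= ln x) = (expR A <= x).
  by rewrite -{1}(expRK A) ler_ln ?posrE ?expR_gt0.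
by near: x; apply: nbhs_pinfty_ge; exact: num_real.
Unshelve. all: by end_near. Qed.

Lemma cvg_expR_ln_shift Y T : 0 < T ->
  expR (- (T * ln (Y + x))) @[x --> +oo] --> (0 : R).
Proof.
move=> T0.
have cT : T * ln (Y + x) @[x --> +oo] --> (+oo : set_system R); last exact: (cvg_comp _ _ cT (@cvgr_expR R)).
apply/cvgryPge => A.
have : \forall x \near +oo, T^-1 * A <= ln x by move/cvgryPge : cvg_ln_pinfty; apply.
move=> [M [Mr HM]]; exists (M - Y); split; first by rewrite realB ?num_real.
by move=> x /= Mx; rewrite -ler_pdivrMl//; apply: HM; rewrite -ltrBlDl.
Qed.

Lemma is_derive_continuous f df x : is_derive x 1 f df -> {for x, continuous f}.
Proof. by move=> fd; apply/differentiable_continuous/derivable1_diffP; have [] := fd. Qed.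

Let continuous_itv f a : (forall x, a <= x -> {for x, continuous f}) ->
  {within `[a, +oo[, continuous f}.
Proof.
move=> cf; apply: continuous_in_subspaceT => x; rewrite inE/= in_itv/= andbT.
exact: cf.
Qed.

Lemma ge0_FTC2y f F a l : (forall x, a <= x -> 0 <= f x) ->
  (forall x, a <= x -> {for x, continuous f}) ->
  (forall x, a <= x -> is_derive x 1 F (f x)) ->
  F x @[x --> +oo] --> l ->
  (\int[leb]_(x in `[a, +oo[) (f x)%:E = (l - F a)%:E)%E.
Proof.
move=> f0 cf dF Fl; rewrite EFinB; apply: ge0_continuous_FTC2y => //.
- exact: continuous_itv.
- by move=> x /ltW/dF[].
- by apply: cvg_at_right_filter; apply: is_derive_continuous; exact: dF.
- by move=> x; rewrite in_itv/= andbT => /ltW/dF[_ <-]; rewrite derive1E.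
Qed.

(** The nonnegative case applies to [g] and to [f + g]; subtract. *)
Lemma dominated_FTC2y f g F G a l m : (forall x, a <= x -> `|f x| <= g x) ->
  (forall x, a <= x -> {for x, continuous f}) ->
  (forall x, a <= x -> {for x, continuous g}) ->
  (forall x, a <= x -> is_derive x 1 F (f x)) ->
  (forall x, a <= x -> is_derive x 1 G (g x)) ->
  F x @[x --> +oo] --> l -> G x @[x --> +oo] --> m ->
  leb.-integrable `[a, +oo[ (EFin \o f) /\
  Rintegral leb `[a, +oo[ f = l - F a.
Proof.
move=> fg cf cg dF dG Fl Gm.
have g0 x : a <= x -> 0 <= g x by move=> /fg; exact: le_trans.
have mc (h : R -> R) : (forall x, a <= x -> {for x, continuous h}) -> measurable_fun `[a, +oo[ h.
  move=> ch; apply: subspace_continuous_measurable_fun => //.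
  exact: continuous_itv.
have Ig := ge0_FTC2y g0 cg dG Gm.
have ig : leb.-integrable `[a, +oo[ (EFin \o g).
  apply/integrableP; split; first by apply/measurable_EFinP; exact: mc.
  under eq_integral.
    move=> x; rewrite inE/= in_itv/= andbT => ax.
    rewrite ger0_norm ?g0//. over.
  by rewrite Ig ltry.
have if_ : leb.-integrable `[a, +oo[ (EFin \o f).
  apply: le_integrable ig => //; first by apply/measurable_EFinP; exact: mc.
  move=> x /=; rewrite in_itv/= andbT => ax.
  by rewrite lee_fin (le_trans (fg _ ax))// ler_norm.
split => //.
have Ifg : (\int[leb]_(x in `[a, +oo[) (f x + g x)%:E = (l + m - (F a + G a))%:E)%E.
  apply: (@ge0_FTC2y (f \+ g) (F \+ G)).
  - move=> x /fg; rewrite ler_norml => /andP[gf _].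
    by rewrite -lerBlDr sub0r.
  - by move=> x ax; apply: continuousD; [exact: cf|exact: cg].
  - by move=> x ax; apply: is_deriveD; [exact: dF|exact: dG].
  - exact: cvgD.
have : Rintegral leb `[a, +oo[ (fun x => f x + g x) = l + m - (F a + G a).
  by rewrite /Rintegral Ifg.
rewrite RintegralD// (_ : Rintegral leb `[a, +oo[ g = m - G a); last by rewrite /Rintegral Ig.
by move=> /(canRL (addrK _)) ->; ring.
Qed.

End real_integrals.

(** * Chains of products of powers *)

Section weights.
Context {R : realType} {r : nat}.
Notation leb := (@lebesgue_measure R).
Notation cube n := (@zetaC_domain R n).
Notation X := (measurableTypeR R).

(** Exponents are kept symbolic: [inl j] is the coordinate [s_j] and [inr m] the
    integer [m]. All integrals met by the recursion then come from countably
    many data, each of which depends on [s] through affine forms. *)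
Definition exponent : Type := ('I_r + int)%type.
(** A list of pairs [(a, c)] stands for the product of the factors
    [(y + a) ^ (- c)]. *)
Definition weight : Type := seq (nat * exponent).

Implicit Types (s : 'rV[R[i]]_r) (e : weight) (es : seq weight) (Y y : R).

Definition ev s (c : exponent) : R[i] :=
  match c with inl j => s 0 j | inr m => m%:~R end.

Definition total s e : R[i] := \sum_(p <- e) ev s p.2.

Definition log_weight s e y : R[i] :=
  - \sum_(p <- e) ev s p.2 * (ln (y + p.1%:R))%:C%C.

(** The logarithm of the integrand: for [xs = x_1, ..., x_n] the [k]-th weight
    is evaluated at [Y + x_1 + ... + x_k]. The starting point [Y] is what makes
    an induction on the first variable possible. *)
Fixpoint phase s es Y (xs : seq R) : R[i] :=
  match es, xs with
  | e :: es', x :: xs' => log_weight s e (Y + x) + phase s es' (Y + x) xs'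
  | _, _ => 0
  end.

Definition chain_integrable s es Y :=
  complex_integrable (lebesgue_tuple R (size es)) (cube (size es))
    (fun t => cexp (phase s es Y t)).

Definition chain_integral s es Y : R[i] :=
  complex_integral (lebesgue_tuple R (size es)) (cube (size es))
    (fun t => cexp (phase s es Y t)).

(** The integral over the variables of [es] decays like the power [- excess] of
    its starting point. *)
Fixpoint excess s es : R[i] :=
  if es is e :: es' then total s e - 1 + excess s es' else 0.

(** Every tail of [es] has excess larger than [b]; [b = 0] is the domain of
    absolute convergence. *)
Fixpoint above (b : R) s es : Prop :=
  if es is e :: es' then b < complex.Re (excess s es) /\ above b s es' else True.

Lemma above_weaken b c s es : c <= b -> above b s es -> above c s es.
Proof. by move=> cb; elim: es => //= e es IH [/(le_lt_trans cb)-> /IH]. Qed.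

Lemma above_excess_ge0 s es : above 0 s es -> 0 <= complex.Re (excess s es).
Proof. by case: es => //= e es [/ltW]. Qed.

Lemma complex_measurable_phase d (T : measurableType d) s es (Y : T -> R)
    (xs : T -> seq R) : measurable_fun setT Y ->
  (forall t, size (xs t) = size es) ->
  (forall i, measurable_fun setT (fun t => nth 0 (xs t) i)) ->
  complex_measurable setT (fun t => phase s es (Y t) (xs t)).
Proof.
elim: es Y xs => [|e es IH] Y xs mY szxs mxs.
  by under eq_fun do rewrite /=; exact: complex_measurable_cst.
have mY' : measurable_fun setT (fun t => Y t + nth 0 (xs t) 0).
  exact: measurable_funD.
have E t : phase s (e :: es) (Y t) (xs t) = log_weight s e (Y t + nth 0 (xs t) 0)
    + phase s es (Y t + nth 0 (xs t) 0) (behead (xs t)).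
  by have := szxs t; case: (xs t).
under eq_fun do rewrite E.
apply: complex_measurableD.
  apply: complex_measurableN; apply: complex_measurable_sum => p.
  apply: complex_measurableM; first exact: complex_measurable_cst.
  apply: complex_measurable_real; apply: measurableT_comp => //.
  by apply: measurable_funD => //; exact: measurable_cst.
apply: IH => // [t|i]; first by rewrite size_behead szxs.
by under eq_fun do rewrite nth_behead; exact: mxs.
Qed.

Lemma measurable_nth_tuple n i :
  measurable_fun setT (fun t : n.-tuple X => nth 0 (t : seq R) i).
Proof.
have [ni|ni] := leqP n i.
  rewrite (_ : (fun _ => _) = cst 0); first exact: measurable_cst.
  by apply/funext => t; rewrite nth_default// size_tuple.
rewrite (_ : (fun _ => _) = (@tnth n X ^~ (Ordinal ni))).
  exact: measurable_tnth.
by apply/funext => t; rewrite (tnth_nth 0).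
Qed.

Lemma complex_measurable_phase_tuple s es Y :
  complex_measurable setT (fun t : (size es).-tuple X => phase s es Y t).
Proof.
apply: complex_measurable_phase; first exact: measurable_cst.
  by move=> t; rewrite size_tuple.
exact: measurable_nth_tuple.
Qed.

(** For [y >= 1] the logarithms of [y] and [y + a] differ by at most
    [ln (1 + a)], so a weight is comparable to the power [y ^ (- total)]; this is
    the logarithm of the comparison constant. *)
Definition weight_bound s e : R :=
  \sum_(p <- e) `|complex.Re (ev s p.2)| * ln (1 + p.1%:R).

Lemma Re_log_weight_le s e y : 1 <= y ->
  complex.Re (log_weight s e y) <=
  weight_bound s e - complex.Re (total s e) * ln y.
Proof.
move=> y1; have y0 : 0 < y by exact: lt_le_trans y1.
rewrite /log_weight /weight_bound /total ReN !Re_sum mulr_suml -sumrN -sumrB.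
apply: ler_sum => -[a c] _ /=; rewrite ReMr; set k := complex.Re _.
have a0 : (0 : R) <= a%:R by [].
have l1 : ln y <= ln (y + a%:R) by rewrite ler_ln ?posrE ?lerDl// ltr_wpDr.
have l2 : ln (y + a%:R) <= ln y + ln (1 + a%:R).
  rewrite -lnM ?posrE ?ltr_wpDr// ler_ln ?posrE ?mulr_gt0 ?ltr_wpDr//.
  by rewrite mulrDr mulr1 lerD2l ler_peMl.
rewrite -subr_ge0.
have -> : `|k| * ln (1 + a%:R) - k * ln y - - (k * ln (y + a%:R)) =
  `|k| * ln (1 + a%:R) + k * (ln (y + a%:R) - ln y) by ring.
have : `|k * (ln (y + a%:R) - ln y)| <= `|k| * ln (1 + a%:R).
  rewrite normrM ler_wpM2l// ger0_norm ?subr_ge0//.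
  by rewrite lerBlDl.
by rewrite ler_norml => /andP[+ _]; rewrite -subr_ge0 opprK addrC.
Qed.

Lemma is_derive_ln_shift Y (x : R) : 0 < Y + x ->
  is_derive x (1 : R) (fun x : R => ln (Y + x)) (Y + x)^-1.
Proof.
move=> Yx.
have dY : is_derive x (1 : R) (fun x : R => Y + x) 1.
  rewrite -[X in is_derive _ _ _ X]add0r.
  exact: (is_deriveD (is_derive_cst Y x 1) (is_derive_id x 1)).
by have := is_derive1_comp (is_derive1_ln Yx) dY; rewrite mulr1.
Qed.

Lemma is_derive_power_shift c Y (x : R) : 0 < Y + x ->
  is_derive x (1 : R) (fun x : R => expR (- (c * ln (Y + x))))
    (- (c * (Y + x)^-1) * expR (- (c * ln (Y + x)))).
Proof.
move=> Yx; have dl := is_derive_ln_shift Yx.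
have dcl : is_derive x (1 : R) (fun x : R => - (c * ln (Y + x))) (- (c * (Y + x)^-1)).
  exact: is_deriveN (is_deriveZ c dl).
by have := is_derive1_comp (is_derive_expR _) dcl; rewrite mulrC.
Qed.

Lemma is_derive_power_shift_primitive T Y (x : R) : 0 < T -> 0 < Y + x ->
  is_derive x (1 : R) (fun x : R => - (T^-1 * expR (- (T * ln (Y + x)))))
    (expR (- ((T + 1) * ln (Y + x)))).
Proof.
move=> T0 Yx.
have dp := is_deriveN (is_deriveZ T^-1 (is_derive_power_shift T Yx)).
suff <- : - (T^-1 *: (- (T / (Y + x)) * expR (- (T * ln (Y + x))))) =
   expR (- ((T + 1) * ln (Y + x))) by exact: dp.
rewrite mulrDl mul1r opprD expRD [expR (- ln _)]expRN lnK ?posrE//.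
by rewrite /GRing.scale /=; field; rewrite !gt_eqF.
Qed.

Lemma integral_power_shift Y T : 0 <= Y -> 0 < T ->
  (\int[leb]_(x in `[1%R, +oo[) (expR (- ((T + 1) * ln (Y + x))))%:E =
   (T^-1 * expR (- (T * ln (Y + 1))))%:E)%E.
Proof.
move=> Y0 T0.
have Yx x : 1 <= x -> 0 < Y + x by move=> x1; rewrite ltr_wpDl// (lt_le_trans _ x1).
pose F x := - (T^-1 * expR (- (T * ln (Y + x)))).
have -> : T^-1 * expR (- (T * ln (Y + 1))) = 0 - F 1 by rewrite sub0r opprK.
apply: (@ge0_FTC2y _ (fun x => expR (- ((T + 1) * ln (Y + x)))) F).
- by move=> *; exact: expR_ge0.
- by move=> x x1; exact: (is_derive_continuous (is_derive_power_shift (T + 1) (Yx _ x1))).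
- by move=> x x1; apply: is_derive_power_shift_primitive => //; exact: Yx.
- rewrite -oppr0 -(mulr0 T^-1); apply: cvgN; apply: cvgMr.
  exact: cvg_expR_ln_shift.
Qed.

End weights.

Arguments exponent r : clear implicits.
Arguments weight r : clear implicits.

(** * Absolute convergence *)

Section chain_convergence.
Context {R : realType} {r : nat}.
Notation leb := (@lebesgue_measure R).
Notation cube n := (@zetaC_domain R n).
Notation X := (measurableTypeR R).
Implicit Types (s : 'rV[R[i]]_r) (e : weight r) (es : seq (weight r)) (Y y : R).

Definition chain_majorant s es Y (t : (size es).-tuple X) : \bar R :=
  (expR (complex.Re (phase s es Y t)))%:E.

Arguments chain_majorant : clear implicits.

Lemma measurable_chain_majorant s es Y :
  measurable_fun setT (chain_majorant s es Y).
Proof.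
apply/measurable_EFinP; apply: measurableT_comp => //.
by have [] := @complex_measurable_phase_tuple R r s es Y.
Qed.

(** Integrating the last variable of a chain turns [y ^ (- T - 1)] into a
    multiple of the power [- T] of the previous partial sum, so the excess is
    exactly the exponent that is carried from one variable to the preceding
    one, and it must stay positive at each stage. *)
Lemma chain_majorant_le s es : above 0 s es ->
  exists2 C : R, 0 <= C & forall Y, 0 <= Y ->
    (\int[lebesgue_tuple R (size es)]_(t in cube (size es)) chain_majorant s es Y t
    <= (C * expR (- (complex.Re (excess s es) * ln (Y + 1))))%:E)%E.
Proof.
elim: es => [_|e es IH /= [T0 aes]].
  exists 1 => // Y Y0; rewrite /chain_majorant /= mul0r oppr0 expR0 mulr1.
  rewrite integral_cst ?mul1e; last exact: (@measurable_cube R 0).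
  rewrite /lebesgue_tuple /= diracE lee_fin; by case: (_ \in _).
have [C C0 HC] := IH aes; have T'0 := above_excess_ge0 aes.
set T := complex.Re (total s e - 1 + excess s es) in T0 *.
pose C' := expR (weight_bound s e) * C.
have C'0 : 0 <= C' by rewrite mulr_ge0 ?expR_ge0.
exists (C' * T^-1); first by rewrite mulr_ge0// invr_ge0 ltW.
move=> Y Y0; rewrite tonelli_tuple; last 2 first.
- exact: (@measurable_chain_majorant s (e :: es) _).
- by move=> t; rewrite lee_fin expR_ge0.
have mpow : measurable_fun setT (fun x : R => (expR (- ((T + 1) * ln (Y + x))))%:E).
  apply/measurable_EFinP; apply: measurableT_comp => //.
  apply: measurable_funN; apply: measurable_funM => //.
  by apply: measurableT_comp => //; exact: measurable_funD.
rewrite -mulrA EFinM -integral_power_shift// -ge0_integralZl//; last first.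
  exact: measurable_funTS.
apply: ge0_le_integral => //.
- by move=> x _; apply: integral_ge0 => t _; rewrite lee_fin expR_ge0.
- apply: measurable_funTS; apply: measurable_tonelli_tuple.
    exact: (@measurable_chain_majorant s (e :: es) _).
  by move=> t; rewrite lee_fin expR_ge0.
- exact/measurable_funeM/measurable_funTS.
move=> x; rewrite /= in_itv/= andbT => x1.
have Yx : 0 <= Y + x by rewrite addr_ge0// (le_trans _ x1).
have Yx1 : 1 <= Y + x by rewrite (le_trans x1)// lerDr.
rewrite /chain_majorant /=.
under eq_integral do rewrite ReD expRD EFinM.
rewrite ge0_integralZl//; last 2 first.
- exact: measurable_cube.
- by apply: measurable_funTS; exact: (@measurable_chain_majorant s es _).
apply: (@le_trans _ _ ((expR (weight_bound s e - complex.Re (total s e) * ln (Y + x)))%:E *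
   (C * expR (- (complex.Re (excess s es) * ln (Y + x))))%:E)%E).
  apply: lee_pmul.
  - by rewrite lee_fin expR_ge0.
  - by apply: integral_ge0 => t _; rewrite lee_fin expR_ge0.
  - by rewrite lee_fin ler_expR Re_log_weight_le.
  - apply: (le_trans (HC _ Yx)); rewrite lee_fin ler_wpM2l// ler_expR lerN2.
    rewrite ler_wpM2l// ler_ln ?posrE ?lerDl//; first exact: lt_le_trans Yx1.
    by rewrite ltr_wpDl.
rewrite -!EFinM lee_fin le_eqVlt; apply/orP; left; apply/eqP.
have -> : expR (- ((T + 1) * ln (Y + x))) =
    expR (- (complex.Re (total s e) * ln (Y + x))) *
    expR (- (complex.Re (excess s es) * ln (Y + x))).
  rewrite -expRD; congr expR; rewrite /T !ReD ReN /=; ring.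
by rewrite /C' expRD; ring.
Qed.

Lemma integrable_chain_majorant s es Y : above 0 s es -> 0 <= Y ->
  (lebesgue_tuple R (size es)).-integrable (cube (size es)) (chain_majorant s es Y).
Proof.
move=> aes Y0; have [C C0 HC] := chain_majorant_le aes; apply/integrableP; split.
  by apply: measurable_funTS; exact: (@measurable_chain_majorant s es Y).
apply: le_lt_trans (le_lt_trans (HC _ Y0) (ltry _)).
rewrite le_eqVlt; apply/orP; left; apply/eqP; apply: eq_integral => t _ /=.
by rewrite ger0_norm ?expR_ge0.
Qed.

Lemma chain_integrableP s es Y : above 0 s es -> 0 <= Y ->
  chain_integrable s es Y.
Proof.
move=> aes Y0; have mD := @measurable_cube R (size es).
have [mR mI] := complex_measurable_cexp (@complex_measurable_phase_tuple R r s es Y).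
apply: (@le_complex_integrable _ _ _ _ _ mD
  (fun t : (size es).-tuple X => expR (complex.Re (phase s es Y t)))).
- exact: integrable_chain_majorant.
- exact: measurable_funTS.
- exact: measurable_funTS.
- by move=> t _; exact: normr_Re_cexp.
- by move=> t _; exact: normr_Im_cexp.
Qed.

Lemma chain_integral_cons s e es Y : above 0 s (e :: es) -> 0 <= Y ->
  complex_integrable leb `[1%R, +oo[
    (fun x => cexp (log_weight s e (Y + x)) * chain_integral s es (Y + x)) /\
  chain_integral s (e :: es) Y = complex_integral leb `[1%R, +oo[
    (fun x => cexp (log_weight s e (Y + x)) * chain_integral s es (Y + x)).
Proof.
move=> aees Y0; have [_ aes] := aees.
have mD := @measurable_cube R (size es).
have E x : 1 <= x -> complex_integrable (lebesgue_tuple R (size es)) (cube (size es))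
      (fun t : (size es).-tuple X => cexp (phase s (e :: es) Y [tuple of x :: t])) /\
    complex_integral (lebesgue_tuple R (size es)) (cube (size es))
      (fun t : (size es).-tuple X => cexp (phase s (e :: es) Y [tuple of x :: t])) =
    cexp (log_weight s e (Y + x)) * chain_integral s es (Y + x).
  move=> x1; have Yx0 : 0 <= Y + x by rewrite addr_ge0// (le_trans _ x1).
  have ies := chain_integrableP aes Yx0.
  have D (t : (size es).-tuple X) : cexp (phase s (e :: es) Y [tuple of x :: t]) =
    cexp (log_weight s e (Y + x)) * cexp (phase s es (Y + x) t).
    by rewrite -cexpD.
  split.
    by apply: eq_complex_integrable (complex_integrableZ mD _ ies) => // t _; rewrite D.
  by under eq_complex_integral do rewrite D; rewrite complex_integralZ.
have [i1 e1] := @complex_fubini_tuple R (size es)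
  (fun t : (size es).+1.-tuple X => cexp (phase s (e :: es) Y t))
  (complex_measurable_cexp (@complex_measurable_phase_tuple R r s (e :: es) Y))
  (chain_integrableP aees Y0) (fun x x1 => (E x x1).1).
have E' x : `[1%R, +oo[%classic x -> 
    complex_integral (lebesgue_tuple R (size es)) (cube (size es))
      (fun t : (size es).-tuple X => cexp (phase s (e :: es) Y [tuple of x :: t])) =
    cexp (log_weight s e (Y + x)) * chain_integral s es (Y + x).
  by rewrite /= in_itv/= andbT => /E[].
split; first by apply: eq_complex_integrable i1.
by rewrite /chain_integral /= e1; apply: eq_complex_integral.
Qed.

Lemma chain_integral_nil s Y : chain_integral s [::] Y = 1.
Proof.
have mD := @measurable_cube R 0.
rewrite /chain_integral; under eq_complex_integral do rewrite /= cexp0.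
rewrite /complex_integral /= !Rintegral_cst// mul0r mul1r.
have c0 : cube 0 = setT by apply/seteqP; split => // t _ [].
rewrite c0; congr (_ +i* _)%C.
by rewrite [X in fine X](@diracT _ (0.-tuple X) R).
Qed.

End chain_convergence.
Arguments chain_majorant {R r} s es Y t.

(** * Complex functions of a real variable *)

Section complex_derivative.
Context {R : realType}.
Notation leb := (@lebesgue_measure R).
Implicit Types (f g : R -> R[i]) (c : R[i]) (x a : R).

Definition has_complex_derivative f x c :=
  is_derive x (1 : R) (fun u : R => complex.Re (f u)) (complex.Re c) /\
  is_derive x (1 : R) (fun u : R => complex.Im (f u)) (complex.Im c).

Lemma has_complex_derivative_cst c x : has_complex_derivative (fun=> c) x 0.
Proof. by split; exact: is_derive_cst. Qed.

Lemma has_complex_derivativeD f g x c c' :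
  has_complex_derivative f x c -> has_complex_derivative g x c' ->
  has_complex_derivative (fun u => f u + g u) x (c + c').
Proof.
move=> [fR fI] [gR gI]; split; under eq_fun do rewrite ?ReD ?ImD;
  rewrite ?ReD ?ImD; exact: is_deriveD.
Qed.

Lemma has_complex_derivativeN f x c : has_complex_derivative f x c ->
  has_complex_derivative (fun u => - f u) x (- c).
Proof.
move=> [fR fI]; split; under eq_fun do rewrite ?ReN ?ImN;
  rewrite ?ReN ?ImN; exact: is_deriveN.
Qed.

Lemma has_complex_derivative_real (h : R -> R) (dh x : R) c :
  is_derive x (1 : R) h dh ->
  has_complex_derivative (fun u => c * (h u)%:C%C) x (c * dh%:C%C).
Proof.
move=> hd; split; under eq_fun do rewrite ?ReMr ?ImMr;
  rewrite ?ReMr ?ImMr; exact: is_deriveZ.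
Qed.

Lemma has_complex_derivative_sum I (s : seq I) (F : I -> R -> R[i]) (dF : I -> R[i]) x :
  (forall i, has_complex_derivative (F i) x (dF i)) ->
  has_complex_derivative (fun u => \sum_(i <- s) F i u) x (\sum_(i <- s) dF i).
Proof.
move=> FD; elim: s => [|i s IH].
  rewrite big_nil; under [X in has_complex_derivative X]eq_fun do rewrite big_nil.
  exact: has_complex_derivative_cst.
rewrite big_cons; under [X in has_complex_derivative X]eq_fun do rewrite big_cons.
exact: has_complex_derivativeD.
Qed.

Let eq_is_derive (h : R -> R) x (d1 d2 : R) :
  is_derive x (1 : R) h d1 -> d1 = d2 -> is_derive x (1 : R) h d2.
Proof. by move=> + <-. Qed.

Lemma has_complex_derivative_cexp f x c : has_complex_derivative f x c ->
  has_complex_derivative (fun u => cexp (f u)) x (c * cexp (f x)).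
Proof.
move=> [fR fI].
have eD := is_derive1_comp (is_derive_expR _) fR.
have cD := is_derive1_comp (is_derive_cos _) fI.
have sD := is_derive1_comp (is_derive_sin _) fI.
split.
- under [X in is_derive _ _ X]eq_fun do rewrite Re_cexp.
  apply: eq_is_derive (is_deriveM eD cD) _.
  rewrite /GRing.scale /= ReM Re_cexp Im_cexp; ring.
- under [X in is_derive _ _ X]eq_fun do rewrite Im_cexp.
  apply: eq_is_derive (is_deriveM eD sD) _.
  rewrite /GRing.scale /= ImM Re_cexp Im_cexp; ring.
Qed.

Definition complex_continuous_at f x :=
  {for x, continuous (fun u : R => complex.Re (f u))} /\
  {for x, continuous (fun u : R => complex.Im (f u))}.

Lemma has_complex_derivative_continuous f x c :
  has_complex_derivative f x c -> complex_continuous_at f x.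
Proof. by move=> [fR fI]; split; [exact: is_derive_continuous fR|exact: is_derive_continuous fI]. Qed.

Lemma complex_continuousD f g x :
  complex_continuous_at f x -> complex_continuous_at g x ->
  complex_continuous_at (fun u => f u + g u) x.
Proof.
move=> [fR fI] [gR gI]; split.
- rewrite (_ : (fun u => _) = (fun u => complex.Re (f u)) \+ (fun u => complex.Re (g u))).
    exact: continuousD.
  by apply/funext => u; rewrite ReD.
- rewrite (_ : (fun u => _) = (fun u => complex.Im (f u)) \+ (fun u => complex.Im (g u))).
    exact: continuousD.
  by apply/funext => u; rewrite ImD.
Qed.

Lemma complex_continuousZ c f x : complex_continuous_at f x ->
  complex_continuous_at (fun u => c * f u) x.
Proof.
move=> [fR fI].
have kf (k : R) (h : R -> R) : {for x, continuous h} -> {for x, continuous (fun u => k * h u)}.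
  by move=> ch; apply: continuousM => //; exact: cst_continuous.
split.
- rewrite (_ : (fun u => _) = (fun u => complex.Re c * complex.Re (f u))
    \- (fun u => complex.Im c * complex.Im (f u))).
    by apply: continuousB; exact: kf.
  by apply/funext => u; rewrite ReM.
- rewrite (_ : (fun u => _) = (fun u => complex.Re c * complex.Im (f u))
    \+ (fun u => complex.Im c * complex.Re (f u))).
    by apply: continuousD; exact: kf.
  by apply/funext => u; rewrite ImM.
Qed.

Lemma complex_continuous_sum I (s : seq I) (F : I -> R -> R[i]) x :
  (forall i, complex_continuous_at (F i) x) ->
  complex_continuous_at (fun u => \sum_(i <- s) F i u) x.
Proof.
move=> cF; elim: s => [|i s IH].
  by under [X in complex_continuous_at X]eq_fun do rewrite big_nil; split; exact: cst_continuous.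
under [X in complex_continuous_at X]eq_fun do rewrite big_cons.
exact: complex_continuousD.
Qed.

Lemma complex_FTC2y f (df : R -> R[i]) (g G : R -> R) a :
  (forall x, a <= x -> `|complex.Re (df x)| <= g x) ->
  (forall x, a <= x -> `|complex.Im (df x)| <= g x) ->
  (forall x, a <= x -> has_complex_derivative f x (df x)) ->
  (forall x, a <= x -> complex_continuous_at df x) ->
  (forall x, a <= x -> {for x, continuous g}) ->
  (forall x, a <= x -> is_derive x (1 : R) G (g x)) ->
  complex.Re (f x) @[x --> +oo] --> (0 : R) ->
  complex.Im (f x) @[x --> +oo] --> (0 : R) ->
  G x @[x --> +oo] --> (0 : R) ->
  complex_integral leb `[a, +oo[ df = - f a.
Proof.
move=> dR dI fd cdf cg dG fR0 fI0 G0; rewrite /complex_integral.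
have [_ ->] := dominated_FTC2y dR (fun x ax => (cdf x ax).1) cg
  (fun x ax => (fd x ax).1) dG fR0 G0.
have [_ ->] := dominated_FTC2y dI (fun x ax => (cdf x ax).2) cg
  (fun x ax => (fd x ax).2) dG fI0 G0.
by rewrite !sub0r; case: (f a).
Qed.

End complex_derivative.

(** * Integration by parts in the last variable *)

Section functional_equation.
Context {R : realType} {r : nat}.
Notation leb := (@lebesgue_measure R).
Implicit Types (s : 'rV[R[i]]_r) (e : weight r) (es : seq (weight r)) (Y y : R).

Lemma has_complex_derivative_log_weight s e Y (x : R) : 0 < Y + x ->
  has_complex_derivative (fun u => log_weight s e (Y + u)) x
    (- \sum_(p <- e) ev s p.2 * ((Y + x + p.1%:R)^-1)%:C%C).
Proof.
move=> Yx; apply: has_complex_derivativeN; apply: has_complex_derivative_sum => p.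
apply: has_complex_derivative_real.
have Yx' : 0 < (Y + p.1%:R) + x by rewrite addrAC ltr_wpDr.
have := is_derive_ln_shift Yx'; rewrite addrAC.
by under eq_fun do rewrite addrAC.
Qed.

Lemma log_weight_cons s a c e y :
  log_weight s ((a, c) :: e) y = - (ev s c * (ln (y + a%:R))%:C%C) + log_weight s e y.
Proof. by rewrite /log_weight big_cons opprD. Qed.

Lemma cexp_ln y : 0 < y -> cexp (ln y)%:C%C = y%:C%C.
Proof. by move=> y0; rewrite /cexp /= lnK ?posrE// cos0 sin0 mulr1. Qed.

Lemma cexp_log_weight_shift s a e y : 0 < y ->
  cexp (log_weight s ((a, inr 1) :: e) y) =
  ((y + a%:R)^-1)%:C%C * cexp (log_weight s e y).
Proof.
move=> y0; rewrite log_weight_cons cexpD /= mul1r; congr (_ * _).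
by rewrite cexpN cexp_ln ?ltr_wpDr// fmorphV.
Qed.

Lemma total_cons s a c e : total s ((a, c) :: e) = ev s c + total s e.
Proof. by rewrite /total big_cons. Qed.

Lemma above_shift b s a e : above b s [:: e] -> above (b + 1) s [:: (a, inr 1) :: e].
Proof.
rewrite /= total_cons /= !addr0 !ReD !ReN /= => -[H _]; split=> //.
lra.
Qed.

Lemma chain_integral_single s e Y : above 0 s [:: e] -> 0 <= Y ->
  complex_integrable leb `[1%R, +oo[ (fun x => cexp (log_weight s e (Y + x))) /\
  chain_integral s [:: e] Y =
    complex_integral leb `[1%R, +oo[ (fun x => cexp (log_weight s e (Y + x))).
Proof.
move=> ae Y0; have [i1 ->] := chain_integral_cons ae Y0.
have E (x : R) : cexp (log_weight s e (Y + x)) * chain_integral s [::] (Y + x) =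
   cexp (log_weight s e (Y + x)) by rewrite chain_integral_nil mulr1.
split; first by apply: eq_complex_integrable i1.
exact: eq_complex_integral.
Qed.

Lemma above0_shift s a e : above 0 s [:: e] -> above 0 s [:: (a, inr 1) :: e].
Proof. by move=> /(above_shift a); apply: above_weaken; rewrite add0r. Qed.

(** Integrate the derivative of [f y = y * w y], where [w] is the weight [e].
    Since [y / (y + a) = 1 - a / (y + a)], the logarithmic derivative of [w]
    gives [f' = (1 - total) * w + sum a * c * w / (y + a)]. Dividing by [y + a]
    raises the total exponent by one, so the new integrals converge in a larger
    domain than the left-hand side, while [a = 0] contributes nothing. *)
Lemma functional_equation1 s e Y : above 0 s [:: e] -> 0 <= Y ->
  (total s e - 1) * chain_integral s [:: e] Y =
  (Y + 1)%:C%C * cexp (log_weight s e (Y + 1)) +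
  \sum_(p <- e) p.1%:R * ev s p.2 * chain_integral s [:: (p.1, inr 1) :: e] Y.
Proof.
move=> ae Y0; have [T0 _] := ae; rewrite /= addr0 ReD ReN /= in T0.
set T := _ - 1 in T0.
have Yx x : 1 <= x -> 0 < Y + x by move=> x1; rewrite ltr_wpDl// (lt_le_trans _ x1).
pose w x := cexp (log_weight s e (Y + x)).
pose wp a x := cexp (log_weight s ((a, inr 1) :: e) (Y + x)).
pose f x := cexp ((ln (Y + x))%:C%C + log_weight s e (Y + x)).
pose df x := (1 - total s e) * w x + \sum_(p <- e) p.1%:R * ev s p.2 * wp p.1 x.
have fE x : 1 <= x -> f x = (Y + x)%:C%C * w x.
  by move=> x1; rewrite /f cexpD cexp_ln ?Yx.
pose h x := 1 - total s e + \sum_(p <- e) p.1%:R * ev s p.2 * ((Y + x + p.1%:R)^-1)%:C%C.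
have dfE x : 1 <= x -> df x = h x * w x.
  move=> x1; rewrite /df /h [RHS]mulrDl; congr (_ + _); rewrite mulr_suml.
  by apply: eq_bigr => p _; rewrite /wp cexp_log_weight_shift ?Yx// mulrA.
have wc x e' : 1 <= x -> complex_continuous_at (fun u => cexp (log_weight s e' (Y + u))) x.
  move=> x1; apply: has_complex_derivative_continuous.
  exact: has_complex_derivative_cexp (has_complex_derivative_log_weight _ _ (Yx _ x1)).
have dfd x : 1 <= x -> has_complex_derivative f x (df x).
  move=> x1; have y0 := Yx _ x1.
  have d1 : has_complex_derivative (fun u => (ln (Y + u))%:C%C) x ((Y + x)^-1)%:C%C.
    have := has_complex_derivative_real 1 (is_derive_ln_shift y0).
    by rewrite mul1r; under eq_fun do rewrite mul1r.
  have := has_complex_derivative_cexp (has_complex_derivativeD d1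
    (has_complex_derivative_log_weight s e y0)).
  rewrite -/(f x) fE// dfE//.
  rewrite [X in has_complex_derivative _ _ X](_ : _ = h x * w x)// mulrA.
  congr (_ * _); rewrite /h mulrDl -rmorphM/= mulVf ?gt_eqF// rmorph1 -addrA.
  congr (_ + _); rewrite /total mulNr mulr_suml -!sumrN -big_split/=.
  apply: eq_bigr => -[a c] _ /=.
  have q : ((Y + x + a%:R)^-1)%:C%C * (Y + x)%:C%C =
      1 - a%:R * ((Y + x + a%:R)^-1)%:C%C :> R[i].
    rewrite -(rmorph_nat (real_complex R)) -!rmorphM/= -(rmorph1 (real_complex R)) -!rmorphB/=.
    by congr (_%:C%C); field; rewrite gt_eqF// ltr_wpDr.
  by rewrite -[X in - X = _]mulrA q; ring.
have wle x : 1 <= x -> expR (complex.Re (log_weight s e (Y + x))) <=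
    expR (weight_bound s e) * expR (- ((T + 1) * ln (Y + x))).
  move=> x1; rewrite -expRD ler_expR /T subrK; apply: Re_log_weight_le.
  by rewrite (le_trans x1)// lerDr.
(* On [1, +oo[ the derivative is bounded by M times the modulus of the weight,
   hence by a power g with primitive G. *)
pose M := `|complex.Re (1 - total s e)| + `|complex.Im (1 - total s e)| +
  \sum_(p <- e) p.1%:R * (`|complex.Re (ev s p.2)| + `|complex.Im (ev s p.2)|).
have hM x : 1 <= x -> `|complex.Re (h x)| + `|complex.Im (h x)| <= M.
  move=> x1; rewrite /h /M ReD ImD.
  apply: (@le_trans _ _ (`|complex.Re (1 - total s e)| +
     `|complex.Re (\sum_(p <- e) p.1%:R * ev s p.2 * ((Y + x + p.1%:R)^-1)%:C%C)| +
     (`|complex.Im (1 - total s e)| +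
     `|complex.Im (\sum_(p <- e) p.1%:R * ev s p.2 * ((Y + x + p.1%:R)^-1)%:C%C)|))).
    by apply: lerD; exact: ler_normD.
  rewrite addrACA lerD2l Re_sum Im_sum.
  apply: (@le_trans _ _ (\sum_(p <- e) `|complex.Re (p.1%:R * ev s p.2 * ((Y + x + p.1%:R)^-1)%:C%C)| +
    \sum_(p <- e) `|complex.Im (p.1%:R * ev s p.2 * ((Y + x + p.1%:R)^-1)%:C%C)|)).
    by apply: lerD; exact: ler_norm_sum.
  rewrite -big_split/=; apply: ler_sum => -[a c] _ /=.
  rewrite ReMr ImMr -(rmorph_nat (real_complex R)) RerM ImrM.
  have q0 : 0 <= (Y + x + a%:R)^-1 by rewrite invr_ge0 addr_ge0// ltW// Yx.
  have q1 : (Y + x + a%:R)^-1 <= 1.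
    rewrite invf_le1; last by rewrite ltr_wpDr// Yx.
    by rewrite -addrA (le_trans x1)// addrCA lerDl addr_ge0.
  rewrite mulrDr !normrM (ger0_norm q0) (@ger0_norm _ a%:R)//.
  by apply: lerD; rewrite ler_piMr// mulr_ge0.
pose g x := M * expR (weight_bound s e) * expR (- ((T + 1) * ln (Y + x))).
pose G x := M * expR (weight_bound s e) * (- (T^-1 * expR (- (T * ln (Y + x))))).
have dfle x : 1 <= x -> `|complex.Re (df x)| <= g x /\ `|complex.Im (df x)| <= g x.
  move=> x1; rewrite dfE//.
  have B (a b u v : R) : `|a| + `|b| <= M ->
      `|u| <= expR (complex.Re (log_weight s e (Y + x))) ->
      `|v| <= expR (complex.Re (log_weight s e (Y + x))) -> `|a * u + b * v| <= g x.
    move=> abM uE vE; apply: (@le_trans _ _ ((`|a| + `|b|) * expR (complex.Re (log_weight s e (Y + x))))).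
      rewrite mulrDl (le_trans (ler_normD _ _))// !normrM lerD// ler_wpM2l//.
    by rewrite /g -mulrA ler_pM ?addr_ge0 ?expR_ge0 ?wle.
  split.
    rewrite ReM -mulrN; apply: B; [exact: hM|exact: normr_Re_cexp|].
    rewrite normrN; exact: normr_Im_cexp.
  by rewrite ImM; apply: B; [exact: hM|exact: normr_Im_cexp|exact: normr_Re_cexp].
have f0le x : 1 <= x -> expR (complex.Re ((ln (Y + x))%:C%C + log_weight s e (Y + x))) <=
    expR (weight_bound s e) * expR (- (T * ln (Y + x))).
  move=> x1; rewrite ReD expRD; apply: (le_trans (ler_wpM2l (expR_ge0 _) (wle _ x1))).
  rewrite mulrCA ler_wpM2l ?expR_ge0// -expRD ler_expR le_eqVlt.
  by apply/orP; left; apply/eqP => /=; ring.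
pose E x := expR (weight_bound s e) * expR (- (T * ln (Y + x))).
have E0 : E x @[x --> +oo] --> (0 : R).
  by rewrite -(mulr0 (expR (weight_bound s e))); apply: cvgMr; exact: cvg_expR_ln_shift.
have E0N : - E x @[x --> +oo] --> (0 : R) by rewrite -oppr0; exact: cvgN.
have to0 (k : R -> R) : (forall x, 1 <= x -> `|k x| <=
    expR (complex.Re ((ln (Y + x))%:C%C + log_weight s e (Y + x)))) ->
    k x @[x --> +oo] --> (0 : R).
  move=> kle; have kE : \forall x \near +oo, - E x <= k x <= E x.
    near=> x; have x1 : 1 <= x by near: x; apply: nbhs_pinfty_ge; exact: num_real.
    by rewrite -ler_norml (le_trans (kle x x1))// f0le.
  exact: squeeze_cvgr kE _ E0N E0.
have := @complex_FTC2y R f df g G 1 (fun x x1 => (dfle x x1).1)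
  (fun x x1 => (dfle x x1).2) dfd.
have cdf x : 1 <= x -> complex_continuous_at df x.
  move=> x1; apply: complex_continuousD; first exact/complex_continuousZ/wc.
  by apply: complex_continuous_sum => p; exact/complex_continuousZ/wc.
move=> /(_ cdf).
have dG (x : R) : 1 <= x -> is_derive x (1 : R) G (g x).
  by move=> x1; exact: (is_deriveZ _ (is_derive_power_shift_primitive T0 (Yx _ x1))).
have cg (x : R) : 1 <= x -> {for x, continuous g}.
  move=> x1; have := is_derive_power_shift (T + 1) (Yx _ x1) => dp.
  exact: (is_derive_continuous (is_deriveZ (M * expR (weight_bound s e)) dp)).
move=> /(_ cg dG).
have fR0 : complex.Re (f x) @[x --> +oo] --> (0 : R).
  by apply: to0 => x _; exact: normr_Re_cexp.
have fI0 : complex.Im (f x) @[x --> +oo] --> (0 : R).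
  by apply: to0 => x _; exact: normr_Im_cexp.
have G0 : G x @[x --> +oo] --> (0 : R).
  rewrite -(mulr0 (M * expR (weight_bound s e))); apply: cvgMr.
  rewrite -oppr0 -(mulr0 T^-1); apply: cvgN; apply: cvgMr.
  exact: cvg_expR_ln_shift.
move=> /(_ fR0 fI0 G0).
have [iw ->] := chain_integral_single ae Y0.
have iwp (p : nat * exponent r) := chain_integral_single (above0_shift p.1 ae) Y0.
rewrite complex_integralD//; last 2 first.
- exact: complex_integrableZ.
- by apply: complex_integrable_sum => // p; apply: complex_integrableZ => //; have [] := iwp p.
rewrite complex_integralZ// complex_integral_sum//; last first.
  by move=> p; apply: complex_integrableZ => //; have [] := iwp p.
rewrite fE// => H.
have -> : \sum_(p <- e) p.1%:R * ev s p.2 * chain_integral s [:: (p.1, inr 1) :: e] Y =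
    \sum_(p <- e) p.1%:R * ev s p.2 * complex_integral leb `[1, +oo[ (wp p.1).
  by apply: eq_bigr => p _; rewrite (iwp p).2.
have E2 : \sum_(p <- e) complex_integral leb `[1, +oo[
      (fun x => p.1%:R * ev s p.2 * wp p.1 x) =
    \sum_(p <- e) p.1%:R * ev s p.2 * complex_integral leb `[1, +oo[ (wp p.1).
  by apply: eq_bigr => p _; rewrite complex_integralZ//; have [] := iwp p.
by rewrite -[X in _ = X + _]opprK -H E2; ring.
Unshelve. all: by end_near. Qed.

End functional_equation.

(** * The functional equation of a chain *)

Section general_functional_equation.
Context {R : realType} {r : nat}.
Notation leb := (@lebesgue_measure R).
Implicit Types (s : 'rV[R[i]]_r) (e : weight r) (es p q : seq (weight r)).
Implicit Types (Y y b : R).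

Definition shift_weight (a : nat) e : weight r := (a, inr 1) :: e.

(** The boundary term of the last integration sits at [y + 1], where [y] is the
    preceding partial sum; it is [y + 1] times the last weight, and it is
    absorbed into the preceding weight. The number of variables drops by one. *)
Definition merge e1 e2 : weight r :=
  e1 ++ (1%N, inr (-1)) :: [seq (c.1.+1, c.2) | c <- e2].

Lemma cexp_log_weight_merge s e1 e2 y : 0 < y ->
  cexp (log_weight s (merge e1 e2) y) =
  cexp (log_weight s e1 y) * ((y + 1)%:C%C * cexp (log_weight s e2 (y + 1))).
Proof.
move=> y0; rewrite /log_weight big_cat big_cons /= big_map opprD cexpD; congr (_ * _).
rewrite mulN1r opprD opprK cexpD cexp_ln ?ltr_wpDr//; congr (_ * cexp (- _)).
by apply: eq_bigr => -[a c] _ /=; rewrite -natr1 addrAC addrA.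
Qed.

Lemma total_merge s e1 e2 : total s (merge e1 e2) = total s e1 + total s e2 - 1.
Proof.
by rewrite /total big_cat big_cons /= big_map -addrA [- 1 + _]addrC.
Qed.

Lemma excess_cat s p q : excess s (p ++ q) = excess s p + excess s q.
Proof. by elim: p => [|e p IH] /=; rewrite ?add0r// IH addrA. Qed.

Lemma above_cat b c s p q q' :
  complex.Re (excess s q') = complex.Re (excess s q) + c ->
  (above b s q -> above (b + c) s q') ->
  above b s (p ++ q) -> above (b + c) s (p ++ q').
Proof.
move=> qq' aqq'; elim: p => //= e p IH [H /IH]; split => //.
by move: H; rewrite !excess_cat !ReD ReN qq'; lra.
Qed.

Lemma above_merge b s p e1 e2 :
  above b s (p ++ [:: e1; e2]) -> above b s (p ++ [:: merge e1 e2]).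
Proof.
rewrite -{2}(addr0 b); apply: above_cat.
  by rewrite [RHS]addr0 /= total_merge; congr complex.Re; ring.
by move=> /= [H _]; split => //; move: H; rewrite total_merge !ReD !ReN /=; lra.
Qed.

Lemma above_shift_last b s p a e :
  above b s (p ++ [:: e]) -> above (b + 1) s (p ++ [:: shift_weight a e]).
Proof.
apply: above_cat; last exact: above_shift.
by rewrite /= total_cons !ReD /=; lra.
Qed.

(** The step of the induction on the preceding variables: a relation between
    chain integrals that holds for all nonnegative starting points is integrated
    against one more weight. *)
Lemma chain_integral_linear s e Y (k : R[i]) es (I : Type) (rI : seq I)
    (kI : I -> R[i]) (esI : I -> seq (weight r)) (G : R -> R[i]) :
  0 <= Y -> above 0 s (e :: es) -> (forall i, above 0 s (e :: esI i)) ->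
  complex_integrable leb `[1%R, +oo[
    (fun x => cexp (log_weight s e (Y + x)) * G (Y + x)) ->
  (forall y, 0 <= y -> k * chain_integral s es y =
    G y + \sum_(i <- rI) kI i * chain_integral s (esI i) y) ->
  k * chain_integral s (e :: es) Y =
  complex_integral leb `[1%R, +oo[ (fun x => cexp (log_weight s e (Y + x)) * G (Y + x)) +
  \sum_(i <- rI) kI i * chain_integral s (e :: esI i) Y.
Proof.
move=> Y0 aes aI iG H.
have [ies ->] := chain_integral_cons aes Y0.
have iI i := chain_integral_cons (aI i) Y0.
rewrite -complex_integralZ//.
have -> : \sum_(i <- rI) kI i * chain_integral s (e :: esI i) Y =
    complex_integral leb `[1%R, +oo[ (fun x => \sum_(i <- rI)
      kI i * (cexp (log_weight s e (Y + x)) * chain_integral s (esI i) (Y + x))).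
  rewrite complex_integral_sum//; last first.
    by move=> i; apply: complex_integrableZ => //; have [] := iI i.
  by apply: eq_bigr => i _; have [? ->] := iI i; rewrite complex_integralZ.
rewrite -complex_integralD//; last first.
  apply: complex_integrable_sum => // i; apply: complex_integrableZ => //.
  by have [] := iI i.
apply: eq_complex_integral => x /=; rewrite in_itv/= andbT => x1.
have Yx : 0 <= Y + x by rewrite addr_ge0// (le_trans _ x1).
rewrite mulrCA H// mulrDr mulr_sumr; congr (_ + _).
by apply: eq_bigr => i _; rewrite mulrCA.
Qed.

(** The one-variable equation of the last integral, integrated against all the
    preceding weights. Shifting the last weight raises the excess of all tails
    at once, because every tail contains it; merging changes none of them. *)
Lemma functional_equation s p e1 e2 Y :
  above 0 s (p ++ [:: e1; e2]) -> 0 <= Y ->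
  (total s e2 - 1) * chain_integral s (p ++ [:: e1; e2]) Y =
  chain_integral s (p ++ [:: merge e1 e2]) Y +
  \sum_(c <- e2) c.1%:R * ev s c.2 *
    chain_integral s (p ++ [:: e1; shift_weight c.1 e2]) Y.
Proof.
elim: p Y => [|e p IH] Y aes Y0.
  have am := @above_merge _ _ [::] _ _ aes.
  have as_ a : above 0 s [:: e1; shift_weight a e2].
    have := @above_shift_last _ _ [:: e1] a _ aes.
    by apply: above_weaken; rewrite add0r.
  have [im Em] := chain_integral_single am Y0.
  have E (x : R) : `[1%R, +oo[%classic x -> cexp (log_weight s (merge e1 e2) (Y + x)) =
      cexp (log_weight s e1 (Y + x)) *
      ((Y + x + 1)%:C%C * cexp (log_weight s e2 (Y + x + 1))).
    rewrite /= in_itv/= andbT => x1; apply: cexp_log_weight_merge.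
    by rewrite ltr_wpDl// (lt_le_trans _ x1).
  have -> : chain_integral s [:: merge e1 e2] Y = complex_integral leb `[1%R, +oo[
      (fun x => cexp (log_weight s e1 (Y + x)) *
      ((Y + x + 1)%:C%C * cexp (log_weight s e2 (Y + x + 1)))).
    by rewrite Em; apply: eq_complex_integral.
  apply: (@chain_integral_linear s e1 Y _ [:: e2] _ e2
    (fun c => c.1%:R * ev s c.2) (fun c => [:: shift_weight c.1 e2])
    (fun y => (y + 1)%:C%C * cexp (log_weight s e2 (y + 1)))) => //.
    by apply: eq_complex_integrable im.
  by move=> y y0; apply: functional_equation1 => //; have [] := aes.
have am := @above_merge _ _ (e :: p) _ _ aes.
have as_ a : above 0 s (e :: p ++ [:: e1; shift_weight a e2]).
  have -> : e :: p ++ [:: e1; shift_weight a e2] =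
    ((e :: p) ++ [:: e1]) ++ [:: shift_weight a e2] by rewrite -catA.
  have := @above_shift_last 0 s ((e :: p) ++ [:: e1]) a e2.
  rewrite -catA => /(_ aes); apply: above_weaken; rewrite add0r//.
have [im Em] := chain_integral_cons am Y0.
rewrite [chain_integral s ((e :: p) ++ [:: merge e1 e2]) Y]Em.
apply: (@chain_integral_linear s e Y _ (p ++ [:: e1; e2]) _ e2
  (fun c => c.1%:R * ev s c.2) (fun c => p ++ [:: e1; shift_weight c.1 e2])
  (fun y => chain_integral s (p ++ [:: merge e1 e2]) y)) => //.
by move=> y y0; apply: IH => //; have [] := aes.
Qed.

End general_functional_equation.

(** * Holomorphy on the domain of convergence *)

Section chain_holomorphy.
Context {R : realType} {r : nat}.
Notation cube n := (@zetaC_domain R n).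
Notation X := (measurableTypeR R).
Implicit Types (s : 'rV[R[i]]_r) (e : weight r) (es : seq (weight r)) (Y y b : R).

(** The exponent is affine in [s], so its coefficients are differences of
    values at the origin and at the basis vectors. This presents a chain
    integral as a Laplace integral, and the measurability of the coefficients
    comes for free. *)
Lemma ev_affine s c : ev s c = ev 0 c +
  \sum_j s 0 j * (ev (delta_mx 0 j) c - ev 0 c) :> R[i].
Proof.
case: c => [i|m] /=; last first.
  rewrite big1 ?addr0// => j _. by rewrite subrr mulr0.
rewrite mxE add0r (bigD1 i)//= !mxE !eqxx subr0 mulr1 big1 ?addr0// => j ji.
by rewrite !mxE eq_sym (negbTE ji) andbF subr0 mulr0.
Qed.

Lemma log_weight_affine s e y : log_weight s e y = log_weight 0 e y +
  \sum_j s 0 j * (log_weight (delta_mx 0 j) e y - log_weight 0 e y).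
Proof.
elim: e => [|[a c] e IH].
  rewrite /log_weight !big_nil !oppr0 big1 ?addr0// => j _.
  by rewrite !big_nil !oppr0 addr0 mulr0.
rewrite log_weight_cons IH {1}(ev_affine s c) [log_weight 0 (_ :: _) _]log_weight_cons.
under [in RHS]eq_bigr do rewrite log_weight_cons.
have -> : \sum_j s 0 j * (- (ev (delta_mx 0 j) c * (ln (y + a%:R))%:C%C) +
    log_weight (delta_mx 0 j) e y - (- (ev 0 c * (ln (y + a%:R))%:C%C) + log_weight 0 e y)) =
  - (\sum_j s 0 j * (ev (delta_mx 0 j) c - ev 0 c)) * (ln (y + a%:R))%:C%C +
  \sum_j s 0 j * (log_weight (delta_mx 0 j) e y - log_weight 0 e y).
  rewrite mulNr mulr_suml -sumrN -big_split/=; apply: eq_bigr => j _; ring.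
ring.
Qed.

Lemma phase_affine s es Y xs : phase s es Y xs = phase 0 es Y xs +
  \sum_j s 0 j * (phase (delta_mx 0 j) es Y xs - phase 0 es Y xs).
Proof.
have z0 : (0 : R[i]) = 0 + \sum_(j < r) s 0 j * (0 - 0).
  rewrite big1 ?addr0// => j _. by rewrite subrr mulr0.
elim: es Y xs => [|e es IH] Y [|x xs]; do ?exact: z0.
have pE w : phase w (e :: es) Y (x :: xs) =
  log_weight w e (Y + x) + phase w es (Y + x) xs by [].
under eq_bigr do rewrite !pE.
rewrite !pE log_weight_affine IH addrACA -big_split/=; congr (_ + _).
apply: eq_bigr => j _; ring.
Qed.

Lemma Im_phase0 (s : 'rV[R[i]]_r) es Y xs : (forall j, complex.Im (s 0 j) = 0) ->
  complex.Im (phase s es Y xs) = 0.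
Proof.
move=> s0; have ev0 c : complex.Im (ev s c) = 0.
  by case: c => [i|m] /=; rewrite ?s0// -(rmorph_int (real_complex R)).
elim: es Y xs => [|e es IH] Y [|x xs] //=.
rewrite ImD IH addr0 /log_weight ImN Im_sum big1 ?oppr0// => c _.
by rewrite ImMr ev0 mul0r.
Qed.

Lemma phase_coord_ge0 j es Y xs : 0 <= Y -> (forall x, x \in xs -> 1 <= x) ->
  0 <= complex.Re (phase 0 es Y xs) - complex.Re (phase (delta_mx 0 j : 'rV[R[i]]_r) es Y xs).
Proof.
have ed c : complex.Re (ev (0 : 'rV[R[i]]_r) c) <= complex.Re (ev (delta_mx 0 j : 'rV[R[i]]_r) c).
  by case: c => [i|m] //=; rewrite !mxE eqxx /=; case: eqP.
elim: es Y xs => [|e es IH] Y [|x xs] Y0 xs1 //=; rewrite ?subrr//.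
have x1 : 1 <= x by apply: xs1; rewrite mem_head.
have Yx : 0 <= Y + x by rewrite addr_ge0// (le_trans _ x1).
rewrite !ReD opprD addrACA addr_ge0//; last first.
  by apply: IH => // x' xs'; apply: xs1; rewrite in_cons xs' orbT.
rewrite /log_weight !ReN opprK addrC !Re_sum -sumrB; apply: sumr_ge0 => c _.
rewrite !ReMr -mulrBl mulr_ge0 ?subr_ge0// ln_ge0//.
by rewrite (le_trans x1)// addrAC lerDr addr_ge0.
Qed.

Lemma continuous_Re : continuous (fun z : R[i] => complex.Re z).
Proof.
move=> z A /nbhs_ballP[e /= e0 eA]; apply/nbhs_ballP.
exists e%:C%C => /=; first by rewrite ltcR.
move=> w zw; apply: eA; rewrite /ball /= -ltcR -ReN -ReD.
exact: le_lt_trans (normc_ge_Re _) zw.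
Qed.

Lemma differentiable_ev c z : differentiable (fun s : 'rV[R[i]]_r => ev s c : R[i]) z.
Proof.
case: c => [j|m] /=; first exact: differentiable_coord.
exact: differentiable_cst.
Qed.

Lemma differentiable_total e z :
  differentiable (fun s : 'rV[R[i]]_r => total s e : R[i]) z.
Proof. by apply: differentiable_bigsum => p; exact: differentiable_ev. Qed.

Lemma differentiable_excess es z :
  differentiable (fun s : 'rV[R[i]]_r => excess s es : R[i]) z.
Proof.
elim: es => [|e es IH] /=; first exact: differentiable_cst.
apply: differentiableD => //; apply: differentiableD; first exact: differentiable_total.
exact: differentiable_cst.
Qed.

Lemma open_above b es : open [set s : 'rV[R[i]]_r | above b s es].
Proof.
elim: es => [|e es IH].
  rewrite (_ : [set _ | _] = setT); first exact: openT.
  by apply/seteqP; split.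
rewrite (_ : [set _ | _] =
  (fun s : 'rV[R[i]]_r => complex.Re (excess s (e :: es))) @^-1` [set t : R | b < t]
  `&` [set s | above b s es])//.
apply: openI => //; apply: open_comp; last exact: open_gt.
move=> s _; apply: (@continuous_comp _ _ _ (fun s : 'rV[R[i]]_r => excess s (e :: es) : R[i])
  (fun z : R[i] => complex.Re z)); last exact: continuous_Re.
exact/differentiable_continuous/differentiable_excess.
Qed.

Lemma above_margin b s es : above b s es ->
  exists2 d : R, 0 < d & above b (s - const_mx d%:C%C) es.
Proof.
move=> ab; have /nbhs_ballP[e /= e0 He] := open_nbhs_nbhs (conj (@open_above b es) ab).
have eE := ge0_real_complex (ltW e0).
have er : 0 < complex.Re e by rewrite -ltcR -eE.
exists (complex.Re e / 2); first by rewrite divr_gt0.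
apply: He; split => // i j; rewrite eE /ball !mxE.
rewrite /ball/= /ball_/= opprB addrC subrK ger0_norm ?ler0c ?divr_ge0 ?(ltW er)//.
by rewrite ltcR ltr_pdivrMr// ltr_pMr ?ltr1n.
Qed.

Lemma differentiable_chain_integral es s : above 0 s es ->
  differentiable (fun s : 'rV[R[i]]_r => chain_integral s es 0 : R[i]) s.
Proof.
move=> aes; have [d d0 ad] := above_margin aes.
pose phi (j : 'I_r) (t : (size es).-tuple X) : R :=
  complex.Re (phase 0 es 0 t) - complex.Re (phase (delta_mx 0 j : 'rV[R[i]]_r) es 0 t).
pose psi (t : (size es).-tuple X) : R := - complex.Re (phase (0 : 'rV[R[i]]_r) es 0 t).
have rl (z : R[i]) : complex.Im z = 0 -> z = (complex.Re z)%:C%C.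
  by case: z => a c /= ->.
have phaseE w (t : (size es).-tuple X) : phase w es 0 t = laplace_exponent phi psi w t.
  rewrite phase_affine /laplace_exponent opprD addrC; congr (_ + _); last first.
    rewrite /psi rmorphN opprK; apply: rl; apply: Im_phase0 => j.
    by rewrite mxE.
  rewrite -sumrN; apply: eq_bigr => j _; rewrite -mulrN; congr (_ * _).
  rewrite /phi rmorphB opprB; congr (_ - _); apply: rl; apply: Im_phase0 => k.
    by rewrite !mxE; case: (_ && _).
  by rewrite mxE.
have mD := @measurable_cube R (size es).
have mph w : measurable_fun (cube (size es))
    (fun t : (size es).-tuple X => complex.Re (phase w es 0 t)).
  apply: measurable_funTS.
  by have [] := @complex_measurable_phase_tuple R r w es 0.
have -> : (fun s => chain_integral s es 0) =
    (fun s => complex_integral (lebesgue_tuple R (size es)) (cube (size es))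
     (fun t => cexp (laplace_exponent phi psi s t))).
  apply/funext => w; rewrite /chain_integral; congr complex_integral.
  by apply/funext => t; rewrite phaseE.
apply: (differentiable_laplace mD _ _ _ d0).
- by move=> j; apply: measurable_funB; exact: mph.
- by apply: measurable_funN; exact: mph.
- move=> j t tD; apply: phase_coord_ge0 => // x /(nthP 0)[i it <-].
  have := tD (Ordinal (eq_ind _ (fun n => (i < n)%N) it _ (size_tuple t))).
  by rewrite (tnth_nth 0).
have E (t : (size es).-tuple X) :
    complex.Re (laplace_exponent phi psi s t) + d * \sum_j phi j t =
    complex.Re (phase (s - const_mx d%:C%C) es 0 t).
  rewrite phaseE /laplace_exponent !ReN !ReD /= !opprD addrAC; congr (_ + _).
  rewrite !Re_sum mulr_sumr -!sumrN -big_split/=; apply: eq_bigr => j _.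
  rewrite !ReMr !mxE ReD ReN /=; ring.
apply: (@eq_integrable _ _ _ _ _ mD (chain_majorant (s - const_mx d%:C%C) es 0)).
  by move=> t _; rewrite /chain_majorant E.
exact: integrable_chain_majorant.
Qed.

End chain_holomorphy.

(** * The continuation *)

Section continuation.
Context {R : realType} {r : nat}.
Implicit Types (s : 'rV[R[i]]_r) (e : weight r) (l es : seq (weight r)).

(** Lists are reversed from here on, so that the last variable comes first. When
    a single variable is left and the starting point is 0, the boundary term is
    the weight at 1. *)
Definition boundary_term s (low : seq (weight r) -> R[i]) e l : R[i] :=
  if l is e1 :: l' then low (merge e1 e :: l') else cexp (log_weight s e 1).

Definition continuation_step s (low same : seq (weight r) -> R[i]) l : R[i] :=
  if l is e :: l' then
    (boundary_term s low e l' +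
     \sum_(c <- e) c.1%:R * ev s c.2 * same (shift_weight c.1 e :: l')) /
    (total s e - 1)
  else 1.

(** [n] is the number of variables and [k] the number of steps by which the
    domain of convergence has been enlarged: one step solves the functional
    equation for the left-hand side, with [k - 1] in place of [k] in the shifted
    integrals. *)
Fixpoint continuation s (n : nat) : nat -> seq (weight r) -> R[i] :=
  if n is n'.+1 then
    fix continuation_k k l :=
      if k is k'.+1 then
        continuation_step s (continuation s n' k) (continuation_k k') l
      else chain_integral s (rev l) 0
  else fun _ _ => 1.

Lemma continuation0 s n l : size l = n ->
  continuation s n 0 l = chain_integral s (rev l) 0.
Proof.
by case: n => //= /eqP/nilP ->; rewrite chain_integral_nil.
Qed.

Lemma rev_cons2 (T : Type) (x y : T) (t : seq T) : rev [:: x, y & t] = rev t ++ [:: y; x].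
Proof. by rewrite !rev_cons -!cats1 -catA. Qed.

Lemma above_rev_merge b s e e1 l :
  above b s (rev [:: e, e1 & l]) -> above b s (rev (merge e1 e :: l)).
Proof. by rewrite rev_cons2 rev_cons -cats1; exact: above_merge. Qed.

Lemma above_rev_shift b s a e l :
  above b s (rev (e :: l)) -> above (b + 1) s (rev (shift_weight a e :: l)).
Proof. by rewrite !rev_cons -!cats1; exact: above_shift_last. Qed.

Lemma above_rev_head b s e l : above b s (rev (e :: l)) -> b < complex.Re (total s e - 1).
Proof.
rewrite rev_cons -cats1; elim: (rev l) => [|e' p IH] /=; first by rewrite addr0 => -[].
by move=> [_ /IH].
Qed.

Lemma continuation_step_integral s l (low same : seq (weight r) -> R[i]) :
  above 0 s (rev l) ->
  (forall l', (size l').+1 = size l -> above 0 s (rev l') ->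
    low l' = chain_integral s (rev l') 0) ->
  (forall l', size l' = size l -> above 0 s (rev l') ->
    same l' = chain_integral s (rev l') 0) ->
  continuation_step s low same l = chain_integral s (rev l) 0.
Proof.
case: l => [|e l] al lowE sameE /=; first by rewrite chain_integral_nil.
have T0 : total s e - 1 != 0.
  by apply/eqP => T0; have := above_rev_head al; rewrite T0 ltxx.
apply: (mulIf T0); rewrite divfK// mulrC.
under eq_bigr => c _.
  rewrite sameE//; last first.
    by have := above_rev_shift c.1 al; apply: above_weaken; rewrite add0r.
  over.
case: l al lowE {sameE} => [|e1 l] al lowE /=.
  rewrite (functional_equation1 (al : above 0 s [:: e]) (lexx _)) add0r.
  by rewrite rmorph1 mul1r.
rewrite lowE//; last exact: above_rev_merge.
rewrite rev_cons2 functional_equation//; last by rewrite -rev_cons2.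
rewrite [rev (_ :: l)]rev_cons -cats1; congr (_ + _).
by apply: eq_bigr => c _; rewrite rev_cons2.
Qed.

(** Successive continuations agree by induction on [k]: the recursion for [k + 1]
    evaluates the shifted data where the statement for [k] applies. The base
    case is the functional equation on the domain of convergence. The equality
    holds even where a denominator vanishes, because both sides are then divided
    by the same 0. *)
Lemma continuation_stable s n k l : size l = n -> above (- k%:R) s (rev l) ->
  continuation s n k.+1 l = continuation s n k l.
Proof.
elim: n k l => [|n IHn] k l; first by [].
have step k' l' : continuation s n.+1 k'.+1 l' = continuation_step s
    (continuation s n k'.+1) (continuation s n.+1 k') l' by [].
elim: k l => [|k IHk] l szl al.
  rewrite oppr0 in al; rewrite step [RHS]continuation0//.
  apply: continuation_step_integral => // l' szl' al'.
  have szn : size l' = n by apply/succn_inj; rewrite szl'.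
  by rewrite IHn ?continuation0// oppr0.
rewrite !step; case: l szl al => [//|e l] szl al; rewrite /continuation_step.
congr (_ / _); congr (_ + _).
  case: l szl al => [//|e1 l] [szl] al /=.
  by rewrite IHn//; exact: above_rev_merge.
apply: eq_bigr => c _; congr (_ * _); apply: IHk => //.
have := above_rev_shift c.1 al; apply: above_weaken.
by rewrite -natr1 opprD subrK.
Qed.

Lemma continuation_stable_le s n k m l : size l = n -> (k <= m)%N ->
  above (- k%:R) s (rev l) -> continuation s n m l = continuation s n k l.
Proof.
move=> szl; elim: m => [|m IH]; first by rewrite leqn0 => /eqP ->.
rewrite leq_eqVlt => /predU1P[-> //|]; rewrite ltnS => km al.
rewrite continuation_stable ?IH//.
by apply: above_weaken al; rewrite lerN2 ler_nat.
Qed.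

Lemma above_exists s es : exists k : nat, above (- k%:R) s es.
Proof.
elim: es => [|e es [k ak]]; first by exists 0%N.
set T := complex.Re (excess s (e :: es)).
exists (maxn k (Num.truncn (- T)).+1); split.
  rewrite ltrNl (lt_le_trans (truncnS_gt _))// ler_nat leq_maxr//.
by apply: above_weaken ak; rewrite lerN2 ler_nat leq_maxl.
Qed.

End continuation.

(** * Quotients by products of affine forms *)

Section polar_quotients.
Context {R : realType} {r : nat}.
Implicit Types (s z : 'rV[R[i]]_r) (e : weight r) (l es : seq (weight r)) (L : seq (weight r)).
Implicit Types (U V : set 'rV[R[i]]_r) (f g h : 'rV[R[i]]_r -> R[i]).

(** A weight with constant exponents gives a constant form [total - 1], which is
    no hyperplane; its inverse is then an ordinary constant factor. *)
Definition varying e : bool := has (fun c => if c.2 is inl _ then true else false) e.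

Definition denominator L s : R[i] := \prod_(e <- L) (total s e - 1).

Definition polar_quotient U f : Prop := exists L g,
  [/\ all varying L, forall z, U z -> differentiable g z &
      forall z, U z -> denominator L z != 0 -> f z = g z / denominator L z].

Lemma differentiable_denominator L z : differentiable (denominator L) z.
Proof.
elim: L => [|e L IH].
  by rewrite /denominator; under eq_fun do rewrite big_nil; exact: differentiable_cst.
rewrite /denominator; under eq_fun do rewrite big_cons.
apply: differentiableM => //; apply: differentiableD; first exact: differentiable_total.
exact: differentiable_cst.
Qed.

Lemma denominator_cat L L' z : denominator (L ++ L') z = denominator L z * denominator L' z.
Proof. by rewrite /denominator big_cat. Qed.

Lemma polar_quotient_sub U V f : V `<=` U -> polar_quotient U f -> polar_quotient V f.
Proof.
move=> VU [L [g [vL dg fg]]]; exists L, g; split=> // z /VU; [exact: dg|exact: fg].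
Qed.

Lemma polar_quotient_differentiable U f :
  (forall z, U z -> differentiable f z) -> polar_quotient U f.
Proof.
move=> df; exists [::], f; split=> // z _ _.
by rewrite /denominator big_nil divr1.
Qed.

Lemma polar_quotientD U f g : polar_quotient U f -> polar_quotient U g ->
  polar_quotient U (fun z => f z + g z).
Proof.
move=> [L [f' [vL df ff]]] [L' [g' [vL' dg gg]]].
exists (L ++ L'), (fun z => f' z * denominator L' z + g' z * denominator L z).
split; first by rewrite all_cat vL.
  move=> z Uz; apply: differentiableD; apply: differentiableM;
    [exact: df|exact: differentiable_denominator|exact: dg|exact: differentiable_denominator].
move=> z Uz; rewrite denominator_cat mulf_eq0 negb_or => /andP[L0 L'0].
by rewrite ff// gg// addf_div.
Qed.

Lemma polar_quotientM U f h : (forall z, U z -> differentiable h z) ->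
  polar_quotient U f -> polar_quotient U (fun z => h z * f z).
Proof.
move=> dh [L [g [vL dg fg]]]; exists L, (fun z => h z * g z); split => // z Uz.
  by apply: differentiableM; [exact: dh|exact: dg].
by move=> /(fg _ Uz) ->; rewrite mulrA.
Qed.

Lemma polar_quotient_sum U (I : Type) (rI : seq I) (F : I -> 'rV[R[i]]_r -> R[i]) :
  (forall i, polar_quotient U (F i)) -> polar_quotient U (fun z => \sum_(i <- rI) F i z).
Proof.
move=> qF; elim: rI => [|i rI IH].
  under [X in polar_quotient _ X]eq_fun do rewrite big_nil.
  by apply: polar_quotient_differentiable => z _; exact: differentiable_cst.
under [X in polar_quotient _ X]eq_fun do rewrite big_cons.
exact: polar_quotientD.
Qed.

Lemma total_constant e z : ~~ varying e -> total z e = total 0 e.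
Proof.
rewrite /varying -all_predC => /allP ve; apply: eq_big_seq => -[a [j|m]] /ve//.
Qed.

Lemma polar_quotient_div U f e : polar_quotient U f ->
  polar_quotient U (fun z => f z / (total z e - 1)).
Proof.
move=> qf; have [ve|ve] := boolP (varying e); last first.
  under [X in polar_quotient _ X]eq_fun do rewrite (total_constant _ ve) mulrC.
  by apply: polar_quotientM => // z _; exact: differentiable_cst.
have [L [g [vL dg fg]]] := qf; exists (e :: L), g; split => //=; first by rewrite ve.
move=> z Uz; rewrite /denominator big_cons mulf_eq0 negb_or => /andP[e0 L0].
by rewrite fg// invfM [X in _ = _ * X]mulrC mulrA.
Qed.

Lemma differentiable_log_weight e y z :
  differentiable (fun s : 'rV[R[i]]_r => log_weight s e y : R[i]) z.
Proof.
apply: differentiableN; apply: differentiable_bigsum => c.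
apply: differentiableM; first exact: differentiable_ev.
exact: differentiable_cst.
Qed.

Lemma differentiable_cexp (z : R[i]) : differentiable (@cexp R) z.
Proof.
have eE : expR (1 : R) >= 0 by exact: expR_ge0.
apply: (@differentiable_quadratic R[i] R[i] R[i] (@cexp R) z (GRing.scale (cexp z))
  (`|cexp z| * (4 * expR 1)%:C%C) 1) => //.
- by rewrite mulr_ge0// ler0c mulr_ge0.
- exact: scaler_continuous.
move=> h h1.
have -> : cexp (h + z) - cexp z - cexp z *: h = cexp z * (cexp h - 1 - h).
  by rewrite cexpD /GRing.scale /=; ring.
rewrite normrM -mulrA ler_wpM2l//.
have hE := ge0_real_complex (normr_ge0 h).
set m := complex.Re `|h| in hE.
have m0 : 0 <= m by rewrite -ler0c -hE.
have m1 : m <= 1 by rewrite -lecR -hE.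
have Rm : `|complex.Re h| <= m by rewrite -lecR -hE normc_ge_Re.
have Im : `|complex.Im h| <= m by rewrite -lecR -hE normc_ge_Im.
have [BR BI] := cexp_remainder Rm Im.
apply: le_trans (normc_le_ReIm _) _.
rewrite hE expr2 -!rmorphM/= lecR; apply: (le_trans (lerD BR BI)).
have : expR m <= expR 1 by rewrite ler_expR.
move=> /(ler_wpM2l (sqr_ge0 m)); rewrite expr2; lra.
Qed.

Lemma polar_quotient_continuation n k l : size l = n ->
  polar_quotient [set s | above (- k%:R) s (rev l)]
    (fun s => continuation s n k l).
Proof.
elim: n k l => [|n IHn] k l.
  by move=> _; apply: polar_quotient_differentiable => z _; exact: differentiable_cst.
elim: k l => [|k IHk] l szl.
  apply: polar_quotient_differentiable => z; rewrite /= oppr0.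
  exact: differentiable_chain_integral.
case: l szl => [//|e l] [szl].
rewrite /=; apply: polar_quotient_div; apply: polar_quotientD.
  case: l szl => [|e1 l] szl /=.
    apply: polar_quotient_differentiable => z _.
    apply: (@differentiable_comp _ _ _ _ (fun s => log_weight s e 1 : R[i]) (@cexp R)).
      exact: differentiable_log_weight.
    exact: differentiable_cexp.
  apply: polar_quotient_sub (IHn _ _ _) => //.
  by move=> s /=; exact: above_rev_merge.
apply: polar_quotient_sum => c; apply: polar_quotientM.
  move=> z _; apply: differentiableM; first exact: differentiable_cst.
  exact: differentiable_ev.
apply: polar_quotient_sub (IHk _ _) => [s /=|]; last by rewrite /= szl.
move=> /(above_rev_shift c.1); apply: above_weaken.
by rewrite -natr1 opprD subrK.
Qed.

End polar_quotients.

(** * Polar hyperplanes *)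

Section hyperplanes.
Context {R : realType} {r : nat}.
Implicit Types (s z : 'rV[R[i]]_r) (e : weight r) (L : seq (weight r)).

Lemma countable_weight (A : set (weight r)) : countable A.
Proof. exact: (@countableP (seq (nat * ('I_r + int)) : countType)). Qed.

(** The derivative of [total] along the vector [(1, ..., 1)]. It is positive for
    each varying weight, so this direction is transverse to all polar
    hyperplanes. *)
Definition slope e : nat := count (fun c => if c.2 is inl _ then true else false) e.

Lemma total_translate z (c : R[i]) e :
  total (z + const_mx c) e = total z e + c * (slope e)%:R.
Proof.
elim: e => [|[a x] e IH]; first by rewrite /total !big_nil mulr0 addr0.
rewrite !total_cons IH /=; case: x => [j|m] /=.
  by rewrite !mxE natrD; ring.
by rewrite addrA.
Qed.

Lemma total_affine z e : total z e = total 0 e +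
  \sum_j (total (delta_mx 0 j : 'rV[R[i]]_r) e - total 0 e) * z 0 j.
Proof.
rewrite /total (eq_bigr _ (fun c _ => ev_affine z c.2)) big_split/=; congr (_ + _).
rewrite exchange_big/=; apply: eq_bigr => j _.
by rewrite -mulr_sumr mulrC sumrB.
Qed.

Lemma affine_hyperplane_total e : varying e ->
  affine_hyperplane [set z : 'rV[R[i]]_r | total z e = 1].
Proof.
move=> ve; pose a : 'rV[R[i]]_r := \row_j (total (delta_mx 0 j : 'rV[R[i]]_r) e - total 0 e).
have aE z : total z e = total 0 e + \sum_j a 0 j * z 0 j.
  by rewrite total_affine; congr (_ + _); apply: eq_bigr => j _; rewrite mxE.
exists a, (1 - total 0 e); split.
  apply/eqP => a0; have := total_translate 0 1 e.
  rewrite aE a0 big1 => [|j _]; last by rewrite mxE mul0r.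
  rewrite mul1r => /addrI/esym/eqP; rewrite pnatr_eq0 /slope -leqn0 leqNgt.
  by rewrite -has_count -/(varying e) ve.
apply/seteqP; split => z /=; rewrite (aE z).
  by move=> <-; rewrite addrAC subrr add0r.
by move=> ->; rewrite addrC subrK.
Qed.

(** Along the real half-line from [z] in the direction [(1, ..., 1)] each factor
    is a nonconstant affine function of the parameter, hence has no zero for
    small positive values. *)
Lemma denominator_neq0_dense L z : all (@varying r) L ->
  closure [set z : 'rV[R[i]]_r | denominator L z != 0] z.
Proof.
move=> vL; have [d d0 dL] : exists2 d : R, 0 < d & forall t : R, 0 < t -> t < d ->
    denominator L (z + const_mx t%:C%C) != 0.
  elim: L vL => [_|e L IH /= /andP[ve /IH[d d0 dL]]].
    by exists 1 => // t _ _; rewrite /denominator big_nil oner_eq0.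
  have [d' d'0 de] : exists2 d' : R, 0 < d' & forall t : R, 0 < t -> t < d' ->
      total (z + const_mx t%:C%C) e - 1 != 0.
    have m0 : (0 < slope e)%N by rewrite /slope -has_count.
    have [z0|z0] := eqVneq (total z e - 1) 0.
      exists 1 => // t t0 _; rewrite total_translate addrAC z0 add0r mulf_neq0//.
        by rewrite -(rmorph0 (real_complex R)) (inj_eq (@complexI R)) gt_eqF.
      by rewrite pnatr_eq0 -lt0n.
    pose q := complex.Re `|total z e - 1|.
    have qE : `|total z e - 1| = q%:C%C by apply: ge0_real_complex.
    have q0 : 0 < q by rewrite -ltcR -qE normr_gt0.
    exists (q / (slope e)%:R); first by rewrite divr_gt0// ltr0n.
    move=> t t0; rewrite ltr_pdivlMr ?ltr0n// => tq.
    rewrite total_translate addrAC addr_eq0; apply/eqP => E.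
    have : `|total z e - 1| = (t * (slope e)%:R)%:C%C.
      rewrite E normrN ger0_norm ?rmorphM/= ?rmorph_nat//.
      by rewrite mulr_ge0// ler0c ltW.
    by rewrite qE => /complexI qt; rewrite qt ltxx in tq.
  exists (Num.min d d'); first by rewrite lt_min d0.
  move=> t t0; rewrite lt_min => /andP[td td'].
  by rewrite /denominator big_cons mulf_neq0 ?de ?dL//; exact: dL.
move=> B /nbhs_ballP[e /= e0 HB].
have eE := ge0_real_complex (ltW e0); have er : 0 < complex.Re e by rewrite -ltcR -eE.
pose t := Num.min (complex.Re e / 2) (d / 2).
have t0 : 0 < t by rewrite lt_min !divr_gt0.
have te : t < complex.Re e by rewrite gt_min ltr_pdivrMr// ltr_pMr ?ltr1n.
have td : t < d by rewrite gt_min [d / 2 < d]ltr_pdivrMr// ltr_pMr ?ltr1n ?orbT.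
exists (z + const_mx t%:C%C); split; first exact: dL.
apply: HB; split => // i j; rewrite eE /ball !mxE /= /ball_ /=.
rewrite opprD addrA subrr add0r normrN ger0_norm ?ler0c ?(ltW t0)//.
by rewrite ltcR.
Qed.

End hyperplanes.

(** * The continuous multiple zeta function *)

Section zetaC_chain.
Context {R : realType}.
Notation cube n := (@zetaC_domain R n).
Notation X := (measurableTypeR R).

Definition zeta_weights (r : nat) : seq (weight r) :=
  [seq [:: (0%N, inl j)] | j <- enum 'I_r].

Lemma size_zeta_weights r : size (zeta_weights r) = r.
Proof. by rewrite size_map size_enum_ord. Qed.

Lemma nth_zeta_weights r (j : 'I_r) : nth [::] (zeta_weights r) j = [:: (0%N, inl j)].
Proof.
by rewrite (nth_map j) ?size_enum_ord// nth_ord_enum.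
Qed.

Lemma phase_sum r (s : 'rV[R[i]]_r) es Y xs : size xs = size es ->
  phase s es Y xs = \sum_(k < size es)
    log_weight s (nth [::] es k) (Y + \sum_(i < k.+1) nth 0 xs i).
Proof.
elim: es Y xs => [|e es IH] Y [|x xs] //=; first by rewrite big_ord0.
move=> [szxs]; rewrite big_ord_recl /= big_ord1 IH//; congr (_ + _).
by apply: eq_bigr => k _; rewrite [in RHS]big_ord_recl /= addrA.
Qed.

Lemma excess_sum r (s : 'rV[R[i]]_r) es j : (j <= size es)%N ->
  excess s (drop j es) = \sum_(j <= k < size es) (total s (nth [::] es k) - 1).
Proof.
elim: es j => [|e es IH] [|j] //=.
- by rewrite big_geq.
- by move=> _; rewrite big_nat_recl//= -[in RHS]IH// drop0.
- by rewrite ltnS => /IH ->; rewrite [RHS]big_add1.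
Qed.

Lemma above_drop r b (s : 'rV[R[i]]_r) es :
  (forall j, (j < size es)%N -> b < complex.Re (excess s (drop j es))) ->
  above b s es.
Proof.
elim: es => //= e es IH H; split; first exact: (H 0%N).
by apply: IH => j js; exact: (H j.+1).
Qed.

Lemma above_zeta_weights r (s : 'rV[R[i]]_r) :
  zetaC_region s -> above 0 s (zeta_weights r).
Proof.
move=> Hs; apply: above_drop => j; rewrite size_zeta_weights => jr.
have := Hs (Ordinal jr); rewrite excess_sum size_zeta_weights; last exact: ltnW.
suff -> : \sum_(j <= k < r) (total s (nth [::] (zeta_weights r) k) - 1) =
    \sum_(i < r | (j <= i)%N) s 0 i - (r%:R - j%:R) :> R[i].
  move=> H; rewrite ReD ReN ReD ReN -!(rmorph_nat (real_complex R)) subr_gt0.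
  exact: H.
rewrite sumrB sumr_const_nat natrB ?(ltnW jr)//; congr (_ - _).
rewrite (big_nat_widenl _ 0)// big_mkord; apply: eq_bigr => i _.
by rewrite nth_zeta_weights /total big_seq1.
Qed.

Lemma chain_integral_size r (s : 'rV[R[i]]_r) n es : size es = n ->
  chain_integral s es 0 = complex_integral (lebesgue_tuple R n) (cube n)
    (fun t => cexp (phase s es 0 t)).
Proof. by move=> <-. Qed.

Lemma chain_integrable_size r (s : 'rV[R[i]]_r) n es : size es = n ->
  chain_integrable s es 0 -> complex_integrable (lebesgue_tuple R n) (cube n)
    (fun t => cexp (phase s es 0 t)).
Proof. by move=> <-. Qed.

Lemma zetaC_integrandE r (s : 'rV[R[i]]_r) (t : r.-tuple X) :
  zetaC_integrand s t = cexp (phase s (zeta_weights r) 0 t).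
Proof.
rewrite phase_sum; last by rewrite size_zeta_weights size_tuple.
rewrite size_zeta_weights /zetaC_integrand.
have -> : \prod_(j < r) cpow (\sum_(i < r | (i <= j)%N) (tnth t i : R)) (s 0 j) =
    cexp (\sum_(j < r) s 0 j * (ln (\sum_(i < r | (i <= j)%N) (tnth t i : R)))%:C%C).
  by rewrite (big_morph _ (@cexpD R) (@cexp0 R)).
rewrite -cexpN -sumrN; congr cexp.
apply: eq_bigr => j _; rewrite nth_zeta_weights /log_weight big_seq1 /= addr0 add0r.
congr (- (_ * (ln _)%:C%C)).
rewrite (big_ord_widen_cond r xpredT (fun i => nth 0 (t : seq R) i)) ?ltn_ord//.
by apply: eq_big => // i _; rewrite (tnth_nth 0).
Qed.

Lemma zetaC_chain_integral r (s : 'rV[R[i]]_r) :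
  zetaC s = chain_integral s (zeta_weights r) 0.
Proof.
rewrite (chain_integral_size _ (size_zeta_weights r)) /zetaC.
by congr complex_integral; apply/funext => t; exact: zetaC_integrandE.
Qed.

Lemma zetaC_convergent_region r (s : 'rV[R[i]]_r) :
  zetaC_region s -> zetaC_convergent s.
Proof.
move=> /above_zeta_weights /chain_integrableP/(_ (lexx 0)) H.
rewrite /zetaC_convergent (_ : zetaC_integrand s = fun t => cexp (phase s (zeta_weights r) 0 t)).
  exact: chain_integrable_size (size_zeta_weights r) H.
by apply/funext => t; exact: zetaC_integrandE.
Qed.

End zetaC_chain.

Section main.
Context {R : realType} {r : nat}.
Implicit Types (s z : 'rV[R[i]]_r).

Let l0 := rev (zeta_weights r).

(** The value does not depend on which admissible number of steps is taken. *)
Definition zeta_continuation s : R[i] :=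
  continuation s r (xget 0%N [set k | above (- k%:R) s (rev l0)]) l0.

Lemma zeta_continuationE s k : above (- k%:R) s (rev l0) ->
  zeta_continuation s = continuation s r k l0.
Proof.
move=> ak; have := @xgetI _ 0%N [set k : nat | above (- k%:R) s (rev l0)] _ ak.
rewrite /zeta_continuation /=; set m := xget _ _ => am.
have szl : size l0 = r by rewrite size_rev size_zeta_weights.
have [km|/ltnW mk] := leqP k m; first by rewrite (@continuation_stable_le _ _ s r k m).
by rewrite (@continuation_stable_le _ _ s r m k).
Qed.

Definition polar_hyperplanes : set (set 'rV[R[i]]_r) :=
  [set [set z | total z e = 1] | e in [set e : weight r | varying e]].

Lemma zeta_continuation_quotient s : exists U L (g : 'rV[R[i]]_r -> R[i]),
  [/\ open_nbhs s U, all (@varying r) L, forall z, U z -> differentiable g z &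
    forall z, U z -> denominator L z != 0 ->
      zeta_continuation z = g z / denominator L z].
Proof.
have [k ak] := above_exists s (rev l0).
have szl : size l0 = r by rewrite size_rev size_zeta_weights.
have [L [g [vL dg fg]]] := @polar_quotient_continuation R r r k l0 szl.
exists [set z | above (- k%:R) z (rev l0)], L, g; split => //.
  by split => //; exact: open_above.
by move=> z Uz dz; rewrite (zeta_continuationE Uz) fg.
Qed.

Lemma singular_set_zeta_continuation :
  singular_set zeta_continuation `<=` \bigcup_(H in polar_hyperplanes) H.
Proof.
move=> s; apply: contra_notP => sH.
have [U [L [g [[oU Us] vL dg fg]]]] := zeta_continuation_quotient s.
have dL : denominator L s != 0.
  elim: L vL {fg} => [_|e L IH /= /andP[ve /IH dL]].
    by rewrite /denominator big_nil oner_eq0.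
  rewrite /denominator big_cons mulf_neq0//; apply/eqP => /subr0_eq e1.
  by apply: sH; exists [set z | total z e = 1] => //; exists e.
pose V := U `&` [set z | denominator L z != 0].
have oV : open V.
  apply: openI => //.
  rewrite (_ : [set z | _] = (denominator L) @^-1` (~` [set 0])).
    apply: open_comp; last first.
      apply: closed_openC.
      exact/accessible_closed_set1/hausdorff_accessible/norm_hausdorff.
    by move=> z _; exact/differentiable_continuous/differentiable_denominator.
  by apply/seteqP; split => z /= /eqP.
have : nbhs s V by apply: open_nbhs_nbhs.
rewrite /holomorphic_at; apply: filterS => w Vw; have [Uw dw] := Vw.
apply: (@near_eq_differentiable _ _ _ _ (fun z => g z / denominator L z)).
  have : nbhs w V by apply: open_nbhs_nbhs.
  by apply: filterS => z [Uz dz]; exact: fg.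
apply: differentiableM; first exact: dg.
by apply: differentiableV => //; exact: differentiable_denominator.
Qed.

Lemma meromorphic_zeta_continuation : meromorphic zeta_continuation.
Proof.
move=> s; have [U [L [g [oU vL dg fg]]]] := zeta_continuation_quotient s.
exists U, g, (denominator L); split => //.
  by move=> z Uz; split; [exact: dg|exact: differentiable_denominator].
by move=> z _; exact: denominator_neq0_dense.
Qed.

End main.

Theorem theorem1p1 (R : realType) (r : nat) (hr : (1 <= r)%N) :
  (forall s : 'rV[R[i]]_r, zetaC_region s -> zetaC_convergent s) /\
  (exists (F : 'rV[R[i]]_r -> R[i]) (HH : set (set 'rV[R[i]]_r)),
     [/\ meromorphic_continuation (@zetaC_region R r) (@zetaC R r) F,
         countable HH,
         forall H, HH H -> affine_hyperplane H &
         singular_set F `<=` \bigcup_(H in HH) H]).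
Proof.
split; first exact: zetaC_convergent_region.
exists zeta_continuation, polar_hyperplanes; split.
- split; first last.
  + move=> s /above_zeta_weights as_; rewrite zetaC_chain_integral.
    rewrite (@zeta_continuationE _ _ s 0) ?revK ?oppr0//.
    by rewrite continuation0 ?revK// size_rev size_zeta_weights.
  + exact: meromorphic_zeta_continuation.
  + move=> s /above_zeta_weights as_; rewrite /holomorphic_at.
    have -> : @zetaC R r = fun z => chain_integral z (zeta_weights r) 0.
      by apply/funext => z; exact: zetaC_chain_integral.
    have : nbhs s [set z | above 0 z (zeta_weights r)].
      by apply: open_nbhs_nbhs; split => //; exact: open_above.
    by apply: filterS => z; exact: differentiable_chain_integral.
- apply: (@sub_countable _ _ _ [set e : weight r | varying e]).
    exact: card_image_le.
  exact: countable_weight.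
- by move=> _ [e ve <-]; exact: affine_hyperplane_total.
- exact: singular_set_zeta_continuation.
Qed.
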